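(* Let $\Gamma\leq \mathrm{PSL}_2(\mathbb{R})$ be a non-elementary Fuchsian group, and let $L(\Gamma)\subseteq\mathbb{R}$ be the set of translation lengths of hyperbolic elements of $\Gamma$. Then $L(\Gamma)$ contains two elements which are linearly independent over $\mathbb{Q}$.
   Context: A non-elementary Fuchsian group is a discrete subgroup of $\mathrm{PSL}_2(\mathbb{R})$ which does not contain a cyclic subgroup of finite index. An element $\gamma\in\mathrm{PSL}_2(\mathbb{R})\setminus\{e\}$ is called hyperbolic if it is diagonalizable over $\mathbb{R}$ (i.e. a matrix in $\mathrm{SL}_2(\mathbb{R})$ representing it is). For hyperbolic $\gamma$, the translation length of $\gamma$ is $\ell(\gamma)=2\log(|\lambda|)$, where $\lambda$ is the eigenvalue of (a matrix representing) $\gamma$ with $|\lambda|\geq 1$; this does not depend on the choice of the representative $\pm\gamma$. The set $L(\Gamma)$ is $\{\ell(\gamma):\gamma\in\Gamma \text{ hyperbolic}\}$. *)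

(* Defs.v *)
From HB Require Import structures.
From mathcomp Require Import all_boot all_order all_algebra.
From mathcomp Require Import all_classical all_reals all_analysis.
From mathcomp Require Import ring lra.

Set Implicit Arguments.
Unset Strict Implicit.
Unset Printing Implicit Defensive.

Import Order.TTheory GRing.Theory Num.Theory.
Import numFieldNormedType.Exports.

Local Open Scope classical_set_scope.
Local Open Scope ring_scope.
Local Open Scope quotient_scope.

(* The coercion to 'M[R]_2 makes SL2 a subtype of the matrices, from which it
   inherits the initial (i.e. subspace) topology. *)
Record SL2 (R : realType) := MkSL2 {
  SL2mx :> 'M[R]_2;
  SL2_det : \det SL2mx == 1 }.

HB.instance Definition _ (R : realType) := [isSub for @SL2mx R].
HB.instance Definition _ (R : realType) := [Choice of SL2 R by <:].
HB.instance Definition _ (R : realType) :=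
  Topological.copy (SL2 R) (initial_topology (@SL2mx R)).

Section SL2Group.
Variable R : realType.
Implicit Types A B C : SL2 R.

Lemma SL2P A B : A = B :> 'M[R]_2 -> A = B.
Proof. exact: val_inj. Qed.

Lemma detSL2 A : \det A = 1.
Proof. exact/eqP/SL2_det. Qed.

Lemma SL2_unit A : (A : 'M[R]_2) \in unitmx.
Proof. by rewrite unitmxE detSL2 unitr1. Qed.

Fact SL2_one_det : \det (1%:M : 'M[R]_2) == 1.
Proof. by rewrite det1. Qed.
Definition SL2_one := MkSL2 SL2_one_det.

Fact SL2_mul_det A B : \det (A *m B) == 1.
Proof. by rewrite det_mulmx !detSL2 mulr1. Qed.
Definition SL2_mul A B := MkSL2 (SL2_mul_det A B).

Fact SL2_inv_det A : \det (invmx A) == 1.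
Proof. by rewrite det_inv detSL2 invr1. Qed.
Definition SL2_inv A := MkSL2 (SL2_inv_det A).

Fact SL2_mulA : associative SL2_mul.
Proof. by move=> A B C; apply: SL2P; rewrite /= mulmxA. Qed.
Fact SL2_mul1g : left_id SL2_one SL2_mul.
Proof. by move=> A; apply: SL2P; rewrite /= mul1mx. Qed.
Fact SL2_mulg1 : right_id SL2_one SL2_mul.
Proof. by move=> A; apply: SL2P; rewrite /= mulmx1. Qed.
Fact SL2_mulVg : left_inverse SL2_one SL2_inv SL2_mul.
Proof. by move=> A; apply: SL2P; rewrite /= mulVmx ?SL2_unit. Qed.
Fact SL2_mulgV : right_inverse SL2_one SL2_inv SL2_mul.
Proof. by move=> A; apply: SL2P; rewrite /= mulmxV ?SL2_unit. Qed.

HB.instance Definition _ :=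
  isGroup.Build (SL2 R) SL2_mulA SL2_mul1g SL2_mulg1 SL2_mulVg SL2_mulgV.

Definition eq_sign A B : bool :=
  ((A : 'M[R]_2) == B) || ((A : 'M[R]_2) == - (B : 'M[R]_2)).

Fact eq_sign_refl : reflexive eq_sign.
Proof. by move=> A; rewrite /eq_sign eqxx. Qed.
Fact eq_sign_sym : symmetric eq_sign.
Proof. by move=> A B; rewrite /eq_sign eq_sym -eqr_oppLR [- _ == _]eq_sym. Qed.
Fact eq_sign_trans : transitive eq_sign.
Proof.
move=> B A C; rewrite /eq_sign => /orP[]/eqP-> /orP[]/eqP->;
  by rewrite ?opprK eqxx ?orbT.
Qed.

Canonical eq_sign_equiv : equiv_rel (SL2 R) :=
  EquivRel eq_sign eq_sign_refl eq_sign_sym eq_sign_trans.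

End SL2Group.

Definition PSL2 (R : realType) : Type :=
  quotient_topology {eq_quot (@eq_sign_equiv R)}.

HB.instance Definition _ (R : realType) := Topological.on (PSL2 R).
HB.instance Definition _ (R : realType) := Quotient.on (PSL2 R).

Section PSL2Group.
Variable R : realType.
Implicit Types A B : SL2 R.
Implicit Types g h k : PSL2 R.

Lemma PSL2_eqP A B :
  \pi_(PSL2 R) A = \pi_(PSL2 R) B <->
  A = B :> 'M[R]_2 \/ A = - (B : 'M[R]_2) :> 'M[R]_2.
Proof.
split=> [/(@eqmodP _ (@eq_sign_equiv R)) /orP[]/eqP|AB]; [by left|by right|].
by apply/(@eqmodP _ (@eq_sign_equiv R)) /orP; case: AB => /eqP; [left|right].
Qed.

Definition PSL2_one : PSL2 R := \pi_(PSL2 R) 1%g.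
Definition PSL2_mul g h : PSL2 R := \pi_(PSL2 R) (repr g * repr h)%g.
Definition PSL2_inv g : PSL2 R := \pi_(PSL2 R) (repr g)^-1%g.

Lemma PSL2_repr A :
  repr (\pi_(PSL2 R) A) = A :> 'M[R]_2 \/
  repr (\pi_(PSL2 R) A) = - (A : 'M[R]_2) :> 'M[R]_2.
Proof. by apply/PSL2_eqP; rewrite reprK. Qed.

Lemma PSL2_mul_pi A B :
  PSL2_mul (\pi_(PSL2 R) A) (\pi_(PSL2 R) B) = \pi_(PSL2 R) (A * B)%g.
Proof.
apply/PSL2_eqP => /=.
by case: (PSL2_repr A) => ->; case: (PSL2_repr B) => ->;
  rewrite ?mulNmx ?mulmxN ?opprK; [left|right|right|left].
Qed.

Lemma PSL2_inv_pi A : PSL2_inv (\pi_(PSL2 R) A) = \pi_(PSL2 R) A^-1%g.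
Proof.
apply/PSL2_eqP => /=; case: (PSL2_repr A) => ->; first by left.
right; rewrite -scaleN1r invmxZ ?invrN1 ?scaleN1r //.
by rewrite -scaleN1r unitmxZ ?unitrN1 ?SL2_unit.
Qed.

Fact PSL2_mulA : associative PSL2_mul.
Proof.
elim/quotW=> A; elim/quotW=> B; elim/quotW=> C.
rewrite (PSL2_mul_pi B) (PSL2_mul_pi A B).
by rewrite (PSL2_mul_pi A (B * C)%g) (PSL2_mul_pi (A * B)%g) mulgA.
Qed.
Fact PSL2_mul1g : left_id PSL2_one PSL2_mul.
Proof. by elim/quotW=> A; rewrite (PSL2_mul_pi 1%g A) mul1g. Qed.
Fact PSL2_mulg1 : right_id PSL2_one PSL2_mul.
Proof. by elim/quotW=> A; rewrite (PSL2_mul_pi A 1%g) mulg1. Qed.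
Fact PSL2_mulVg : left_inverse PSL2_one PSL2_inv PSL2_mul.
Proof. by elim/quotW=> A; rewrite PSL2_inv_pi (PSL2_mul_pi A^-1%g A) mulVg. Qed.
Fact PSL2_mulgV : right_inverse PSL2_one PSL2_inv PSL2_mul.
Proof. by elim/quotW=> A; rewrite PSL2_inv_pi (PSL2_mul_pi A A^-1%g) mulgV. Qed.

HB.instance Definition _ :=
  isGroup.Build (PSL2 R) PSL2_mulA PSL2_mul1g PSL2_mulg1 PSL2_mulVg PSL2_mulgV.

End PSL2Group.

Definition cyclic_subgroup (G : groupType) (g : G) : set G :=
  [set h | exists n : nat, h = (g ^+ n)%g \/ h = (g ^- n)%g].

Definition finite_index (G : groupType) (H K : set G) : Prop :=
  H `<=` K /\ finite_set [set [set (x * h)%g | h in H] | x in K].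

Definition elementary (G : groupType) (K : set G) : Prop :=
  exists g : G, finite_index (cyclic_subgroup g) K.

Definition discrete_subset (T : topologicalType) (A : set T) : Prop :=
  A `<=` isolated A.

Definition Fuchsian (R : realType) (Gamma : set (PSL2 R)) : Prop :=
  group_closed [in Gamma] /\ discrete_subset Gamma.

Definition hyperbolic (R : realType) (g : PSL2 R) : Prop :=
  g <> 1%g /\ diagonalizable (repr g : 'M[R]_2).

(* The default value 1 is only reached when no eigenvalue is real; by
   translation_length_pi below, neither the representative of g nor the choice
   of the eigenvalue matters. *)
Definition translation_length (R : realType) (g : PSL2 R) : R :=
  2 * ln `|xget 1 [set x | eigenvalue (repr g : 'M[R]_2) x /\ 1 <= `|x|]|.

Lemma hyperbolic_pi (R : realType) (A : SL2 R) :
  hyperbolic (\pi_(PSL2 R) A) <->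
  \pi_(PSL2 R) A <> 1%g /\ diagonalizable (A : 'M[R]_2).
Proof.
rewrite /hyperbolic; case: (PSL2_repr A) => ->//.
suff dN (B : 'M[R]_2) : diagonalizable B -> diagonalizable (- B).
  by split=> -[? /dN]; rewrite ?opprK.
case=> P Pu /diagonalizable_forPex [D /(simmxP Pu) PD]; exists P => //.
apply/diagonalizable_forPex; exists (- D); apply/(simmxP Pu).
by rewrite mulmxN PD raddfN mulNmx.
Qed.

Lemma SL2_eigenvalue (R : realType) (A : SL2 R) (x : R) :
  eigenvalue (A : 'M[R]_2) x -> x ^+ 2 - \tr A * x + 1 = 0.
Proof.
rewrite eigenvalue_root_char => /rootP.
rewrite horner_coef size_char_poly !big_ord_recr big_ord0 /= add0r.
rewrite char_poly_det (char_poly_trace _ (isT : (0 < 2)%N)) detSL2.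
have /monicP := char_poly_monic (A : 'M[R]_2).
rewrite lead_coefE size_char_poly /= => ->; rewrite expr0 => <-; ring.
Qed.

Lemma translation_length_pi (R : realType) (A : SL2 R) (x : R) :
  eigenvalue (A : 'M[R]_2) x -> 1 <= `|x| ->
  translation_length (\pi_(PSL2 R) A) = 2 * ln `|x|.
Proof.
move=> Ax x1; rewrite /translation_length.
have uniq (B : SL2 R) (y z : R) : eigenvalue (B : 'M[R]_2) y -> 1 <= `|y| ->
    eigenvalue (B : 'M[R]_2) z -> 1 <= `|z| -> `|y| = `|z|.
  move=> /SL2_eigenvalue By y1 /SL2_eigenvalue Bz z1.
  have /eqP : (y - z) * (y * z - 1) = 0.
    transitivity (z * (y ^+ 2 - \tr B * y + 1) - y * (z ^+ 2 - \tr B * z + 1)).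
      by ring.
    by rewrite By Bz !mulr0 subr0.
  rewrite mulf_eq0 !subr_eq0 => /orP[/eqP->//|/eqP yz].
  have : `|y| * `|z| = 1 by rewrite -normrM yz normr1.
  by nra.
suff [y Ay yx] : exists2 y,
    eigenvalue (repr (\pi_(PSL2 R) A) : 'M[R]_2) y & `|y| = `|x|.
  have [|By B1] := @xgetPex _ 1
      [set z | eigenvalue (repr (\pi_(PSL2 R) A) : 'M[R]_2) z /\ 1 <= `|z|].
    by exists y; rewrite /= yx.
  by rewrite (uniq _ _ _ By B1 Ay) ?yx.
case: (PSL2_repr A) => ->; first by exists x.
exists (- x); last by rewrite normrN.
have /eigenvalueP [v vA v0] := Ax; apply/eigenvalueP; exists v => //.
by rewrite mulmxN vA scaleNr.
Qed.

Definition length_set (R : realType) (Gamma : set (PSL2 R)) : set R :=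
  [set translation_length g | g in [set g | Gamma g /\ hyperbolic g]].

Definition Q_independent (R : realType) (x y : R) : Prop :=
  forall a b : rat, ratr a * x + ratr b * y = 0 -> a = 0 /\ b = 0.

(* Main.v *)
(** Suppose that all translation lengths are pairwise dependent over Q, and
    conjugate the preimage T of Gamma in SL2(R) so that it contains
    a = diag(l, 1/l) with l > 1.  For b = (p, q; r, s) in T with p > 0 the
    element a^n b is hyperbolic for large n; its eigenvalue mu_n > 1 satisfies
    mu_n + 1/mu_n = t_n with t_n = l^n p + l^-n s, and a power of mu_n is a
    power of l.  If mu_(n+1) = l mu_n for a single n, then p s = 1.

    If l is transcendental, the recurrence t_(n+1) + t_(n-1) = (l + 1/l) t_n is
    a Laurent polynomial identity in a common root of l, mu_(n-1), mu_n and
    mu_(n+1), and comparing exponents gives mu_(n+1) = l mu_n.  If l is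
    algebraic, then mu_n = l^(M/N) in lowest terms implies that l^(1/N) has
    degree bounded independently of n, so that l^(1/N) stays away from 1 and N
    is bounded; hence a fixed power of mu_n is an integral power of l for all n,
    and mu_(n+1) / mu_n --> l forces mu_(n+1) = l mu_n for large n.

    Hence every b in T is triangular or antidiagonal.  Conjugating a nontrivial
    unipotent element by powers of a contradicts discreteness, so T is diagonal
    up to index 2, and its diagonal part is cyclic up to sign.  Without
    hyperbolic elements, T consists either of rotations, hence is finite, or of
    unipotent elements up to sign fixing a common point, hence is cyclic. *)

Require Import Defs.
From mathcomp Require Import all_boot all_order all_algebra all_field.
From mathcomp Require Import all_classical all_reals all_analysis.
From mathcomp Require Import complex ring lra zify.

Set Implicit Arguments.
Unset Strict Implicit.
Unset Printing Implicit Defensive.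

Import Order.TTheory GRing.Theory Num.Theory.
Import numFieldNormedType.Exports.

Local Open Scope classical_set_scope.
Local Open Scope ring_scope.
Local Open Scope quotient_scope.

(** * Algebraic numbers *)

(** The bound is the sum of [N] over the list of all roots. *)
Lemma poly_roots_bounded (C : closedFieldType) (D : numDomainType)
    (N : C -> D) (p : {poly C}) :
  (forall z, 0 <= N z) -> p != 0 ->
  exists2 B, 0 <= B & forall z, root p z -> N z <= B.
Proof.
move=> N0 p0; have [r Dp] := closed_field_poly_normal p.
exists (\sum_(z <- r) N z) => [|z]; first exact: sumr_ge0.
rewrite {1}Dp rootZ ?lead_coef_eq0// root_prod_XsubC => zr.
by rewrite (big_rem _ zr)/= lerDl sumr_ge0.
Qed.

(* The value at 1 is a nonzero integer, namely the leading coefficient times the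
   product of the differences 1 - z over the roots z. *)
Lemma int_poly_root_gap (C : numClosedFieldType) (P : {poly int}) (B : C)
    (E : nat) (y : C) :
  P.[1] != 0 -> root (map_poly intr P) y -> 0 <= B ->
  (forall z, root (map_poly intr P) z -> `|z| <= B) -> (size P <= E.+1)%N ->
  1 <= `|(lead_coef P)%:~R| * (1 + B) ^+ E * `|1 - y|.
Proof.
move=> P1 Py B0 PB sP.
have P0 : P != 0 by apply: contraNneq P1 => ->; rewrite horner0.
set Q := map_poly intr P in Py PB *.
have Q0 : Q != 0 by rewrite map_poly_eq0_id0// intr_eq0 lead_coef_eq0.
have sQ : size Q = size P by rewrite size_map_poly_id0// intr_eq0 lead_coef_eq0.
have lQ : lead_coef Q = (lead_coef P)%:~R.
  by rewrite lead_coef_map_eq// intr_eq0 lead_coef_eq0.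
have [r Dp] := closed_field_poly_normal Q.
have rQ z : (z \in r) = root Q z.
  by rewrite {1}Dp rootZ ?lead_coef_eq0// root_prod_XsubC.
have sr : size Q = (size r).+1.
  by rewrite Dp size_scale ?lead_coef_eq0// size_prod_XsubC.
have Q1 : 1 <= `|Q.[1]|.
  rewrite -(rmorph1 (intr : int -> C)) horner_map/= -intr_norm.
  by rewrite ler1z -gtz0_ge1 normr_gt0.
apply: (le_trans Q1); rewrite Dp hornerZ normrM lQ -mulrA.
apply: ler_wpM2l; rewrite ?normr_ge0//.
have yr : y \in r by rewrite rQ.
rewrite horner_prod (big_rem _ yr)/= normrM !hornerE mulrC.
apply: ler_wpM2r; rewrite ?normr_ge0//.
rewrite normr_prod.
have srE : (size (rem y r) <= E)%N.
  by rewrite size_rem// (leq_trans (leq_pred _))// -ltnS -sr sQ.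
(* With the factor of [y] split off, at most [E] factors [1 - z] remain, each of norm at most
   [1 + B]; as [1 + B] is at least 1, missing factors may be filled in. *)
apply: le_trans (_ : (1 + B) ^+ size (rem y r) <= _); last first.
  by rewrite ler_weXn2l// lerDl.
have: {subset rem y r <= r} by move=> z; apply: mem_rem.
elim: (rem y r) => [|z s IHs] sr'; first by rewrite big_nil.
rewrite big_cons exprS ler_pM ?normr_ge0 ?prodr_ge0 ?IHs//; last first.
  by move=> w ws; apply: sr'; rewrite inE ws orbT.
rewrite !hornerE; apply: (le_trans (ler_normB _ _)).
by rewrite normr1 lerD2l PB// -rQ sr' ?mem_head.
Qed.

(* With y ^ N fixed, the gcd of f and g(X^N) bounds the degree, the leading
   coefficient and the conjugates of y independently of N. *)
Lemma root_near_one (R : rcfType) (g : {poly int}) (E : nat) : g != 0 ->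
  exists2 d : R, 0 < d & forall (N : nat) (y : R) (f : {poly rat}),
    (0 < N)%N -> 1 < y -> f != 0 -> (size f <= E.+1)%N ->
    root (map_poly ratr f) y -> root (map_poly intr g) (y ^+ N) -> 1 + d <= y.
Proof.
move=> g0; pose gC : {poly R[i]} := map_poly intr g.
have gC0 : gC != 0 by rewrite map_poly_eq0_id0// intr_eq0 lead_coef_eq0.
have [B B0 gB] := poly_roots_bounded (@normr_ge0 _ R[i]) gC0.
have Breal : B = (complex.Re B)%:C%C.
  by case: B B0 {gB} => b1 b2; rewrite lecE/= => /andP[/eqP-> _].
set b := complex.Re B in Breal.
have b0 : 0 <= b by move: B0; rewrite Breal lecR.
have lg0 : 0 < `|lead_coef g|%:~R :> R by rewrite ltr0z normr_gt0 lead_coef_eq0.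
(* This is the constant of [int_poly_root_gap] for the leading coefficient of [g] and the root bound
   [1 + B], so that the base is [1 + (1 + b)]. *)
set c : R := `|lead_coef g|%:~R * (2 + b) ^+ E.
have c0 : 0 < c by rewrite mulr_gt0// exprn_gt0//; lra.
exists c^-1; rewrite ?invr_gt0// => N y f N0 y1 f0 sf fy gy.
have y1' : y != 1 by rewrite gt_eqF.
pose gN := g \Po 'X^N.
have gN0 : gN != 0 by rewrite comp_poly_eq0// size_polyXn.
pose ZQ : {poly int} -> {poly rat} := map_poly intr.
have ZQ0 p : (ZQ p == 0) = (p == 0).
  have [->|p0] := eqVneq p 0; first by rewrite /ZQ map_poly0 eqxx.
  by rewrite map_poly_eq0_id0 ?(negPf p0)// intr_eq0 lead_coef_eq0.
have ratint (p : {poly int}) : map_poly ratr (ZQ p) = map_poly intr p :> {poly R}.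
  by rewrite -map_poly_comp; apply: eq_map_poly => z /=; rewrite ratr_int.
have root_gN (K : numFieldType) (z : K) :
    root (map_poly intr gN) z = root (map_poly intr g) (z ^+ N).
  by rewrite /gN map_comp_poly map_polyXn /root horner_comp hornerXn.
pose h := gcdp f (ZQ gN).
have h0 : h != 0 by rewrite gcdp_eq0 negb_and f0.
have hy : root (map_poly ratr h) y.
  by rewrite gcdp_map root_gcd fy ratint root_gN.
(* The gap lemma needs a nonzero value at 1, so all factors ['X - 1] are divided out; the root
   [y > 1] survives. *)
have [m [q]] := multiplicity_XsubC h 1; rewrite h0 /= => q1 Dh.
have qy : root (map_poly ratr q) y.
  move: hy; rewrite Dh rmorphM rmorphXn rootM /= => /orP[//|].
  rewrite map_polyXsubC rmorph1 => /rootP/eqP.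
  by rewrite !hornerE expf_eq0 subr_eq0 (negPf y1') andbF.
have qh : q %| h by rewrite Dh dvdp_mulr.
have q0 : q != 0 by apply: contraTneq h0 => q0; rewrite Dh q0 mul0r eqxx.
have [P [a a0 DP]] := rat_poly_scale q.
have a0' : a%:~R^-1 != 0 :> rat by rewrite invr_eq0 intr_eq0.
have P0 : P != 0 by rewrite -ZQ0; apply: contraTneq q0 => P0; rewrite DP -/(ZQ P) P0 scaler0 eqxx.
(* Gauss's lemma: the primitive integral multiple of [q] divides g(X^N) over the integers, so its
   leading coefficient divides that of [g]. *)
have [P' DP' [r Dr]] : exists2 P', P = zcontents P *: P' & exists r, gN = P' * r.
  exists (zprimitive P); first exact: zpolyEprim.
  suff [r] : {r | gN = zprimitive P * r} by exists r.
  apply: dvdpP_int; rewrite -dvdp_rat_int -/(ZQ P) -/(ZQ gN).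
  apply: dvdp_trans (_ : q %| _); first by rewrite DP dvdpZr.
  exact: dvdp_trans qh (dvdp_gcdr _ _).
have cP : zcontents P != 0 by rewrite zcontents_eq0.
have P'0 : P' != 0 by apply: contraTneq P0 => P'0; rewrite DP' P'0 scaler0 eqxx.
have qP' : q = (a%:~R^-1 * (zcontents P)%:~R) *: ZQ P'.
  by rewrite DP {1}DP' map_polyZ/= scalerA.
have P'y : root (map_poly intr P') y.
  by move: qy; rewrite qP' map_polyZ rootZ ?fmorph_eq0 ?mulf_neq0 ?intr_eq0// ratint.
have P'1 : P'.[1] != 0.
  apply: contraNneq q1 => P'1; rewrite qP' rootZ ?mulf_neq0 ?intr_eq0//.
  by rewrite /root -(rmorph1 (intr : int -> rat)) horner_map P'1 rmorph0.
have sP' : (size P' <= E.+1)%N.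
  apply: leq_trans sf; apply: leq_trans (dvdp_leq f0 (dvdp_gcdl f (ZQ gN))).
  apply: leq_trans (dvdp_leq h0 qh).
  rewrite qP' size_scale ?mulf_neq0 ?intr_eq0//.
  by rewrite /ZQ size_map_poly_id0// intr_eq0 lead_coef_eq0.
have lP' : `|lead_coef P'| <= `|lead_coef g|.
  have /(congr1 lead_coef) := Dr.
  rewrite lead_coef_comp ?size_polyXn// lead_coefXn expr1n mulr1 lead_coefM => ->.
  rewrite normrM ler_peMr// -gtz0_ge1 normr_gt0 lead_coef_eq0.
  by apply: contraNneq gN0 => r0; rewrite Dr r0 mulr0.
(* A root [z] of [P'] satisfies [|z| ^+ N <= B], whence [|z| <= max(1, B)] whatever [N] is. *)
have P'B (z : R[i]) : root (map_poly intr P') z -> `|z| <= 1 + B.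
  move=> Pz; have : root (map_poly intr gN) z by rewrite Dr rmorphM rootM Pz.
  rewrite root_gN => /gB; rewrite normrX => zN.
  have [z1|/ltW z1] := real_leP (normr_real z) (real1 _).
    by rewrite (le_trans z1)// lerDl.
  apply: le_trans (_ : B <= _); last by rewrite lerDr.
  by apply: le_trans zN; rewrite ler_eXnr.
have P'yC : root (map_poly intr P') y%:C%C.
  have := P'y; rewrite -(fmorph_root (real_complex R)) -map_poly_comp.
  by rewrite (@eq_map_poly _ _ _ intr)// => z /=; rewrite rmorph_int.
have B1 : 0 <= 1 + B by rewrite addr_ge0.
have := int_poly_root_gap P'1 P'yC B1 P'B sP'.
rewrite Breal.
have -> : `|(lead_coef P')%:~R| * (1 + (1 + b%:C%C)) ^+ E * `|1 - y%:C%C|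
    = (`|lead_coef P'|%:~R * (2 + b) ^+ E * (y - 1))%:C%C.
  have -> : `|1 - y%:C%C| = (y - 1)%:C%C.
    rewrite -normrN opprB -(rmorph1 (real_complex R)) -rmorphB ger0_norm//.
    by rewrite lecR subr_ge0 ltW.
  have -> : 2 + b = 1 + (1 + b) by ring.
  by rewrite -intr_norm !rmorphM rmorphXn !(rmorphD, rmorph1) rmorph_int.
rewrite -[1 in leLHS](rmorph1 (real_complex R)) lecR => le1.
have y10 : 0 < y - 1 by rewrite subr_gt0.
have : 1 <= c * (y - 1).
  apply: le_trans le1 _; rewrite ler_wpM2r ?(ltW y10)// ler_wpM2r ?exprn_ge0 ?ler_int//; lra.
by rewrite -ler_pdivrMl// mulr1; lra.
Qed.

(** Membership of [x] in the ring Q[z]. *)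
Definition ratalg (R : numFieldType) (z x : R) : Prop :=
  exists p : {poly rat}, x = (map_poly ratr p).[z].

Section RatAlg.
Variables (R : numFieldType) (z : R).

Lemma ratalg0 : ratalg z 0.
Proof. by exists 0; rewrite rmorph0 horner0. Qed.

Lemma ratalg1 : ratalg z 1.
Proof. by exists 1; rewrite rmorph1 hornerE. Qed.

Lemma ratalgD x y : ratalg z x -> ratalg z y -> ratalg z (x + y).
Proof. by move=> [p ->] [q ->]; exists (p + q); rewrite rmorphD hornerD. Qed.

Lemma ratalgN x : ratalg z x -> ratalg z (- x).
Proof. by move=> [p ->]; exists (- p); rewrite rmorphN hornerN. Qed.

Lemma ratalgM x y : ratalg z x -> ratalg z y -> ratalg z (x * y).
Proof. by move=> [p ->] [q ->]; exists (p * q); rewrite rmorphM hornerM. Qed.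

Lemma ratalg_trans y x : ratalg z y -> ratalg y x -> ratalg z x.
Proof.
by move=> [p ->] [q ->]; exists (q \Po p); rewrite map_comp_poly horner_comp.
Qed.

(** Reduction modulo [q] gives the elements of Q[z] coordinate vectors of a fixed length. *)
Lemma ratalg_small (q p : {poly rat}) : q != 0 -> root (map_poly ratr q) z ->
  exists2 p' : {poly rat}, (size p' < size q)%N &
    (map_poly ratr p').[z] = (map_poly ratr p).[z].
Proof.
move=> q0 /rootP qz; exists (p %% q); first by rewrite ltn_modp.
by rewrite {2}(divp_eq p q) rmorphD rmorphM /= hornerD hornerM qz mulr0 add0r.
Qed.

End RatAlg.

(** Primitive element theorem, one element at a time: some [z *+ n - x] generates both [z] and
    [x]. *)
Lemma algebraic_primitive (R : numFieldType) (s : seq R) :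
  (forall x, x \in s -> algebraicOver (ratr : rat -> R) x) ->
  exists2 z, algebraicOver (ratr : rat -> R) z & forall x, x \in s -> ratalg z x.
Proof.
elim: s => [_|x s IHs sA]; first by exists 0 => //; exact: algebraic0.
have [|z zA sz] := IHs; first by move=> y ys; apply: sA; rewrite inE ys orbT.
have xA : algebraicOver (ratr : rat -> R) x by apply: sA; rewrite mem_head.
have [[p p0 px] [q q0 qz]] := (xA, zA).
have [n [[p1 Dx] [q1 Dz]]] := pchar0_PET p0 px q0 qz (pchar_num _).
exists (z *+ n - x).
  apply: algebraic_sub => //; rewrite -mulr_natr; apply: algebraic_mul => //.
  rewrite -(rmorph_nat (ratr : rat -> R)); exact: algebraic_id.
move=> y; rewrite inE => /orP[/eqP->|/sz ys]; first by exists p1.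
by apply: ratalg_trans ys; exists q1.
Qed.

(** All powers of [y] lie in Q[z] + Q[z] mu, which has fewer than [d + d] dimensions over Q, so the
    first [d + d + 1] of them are linearly dependent. The bound depends on [z] alone, uniformly in
    [t], [mu] and [y]. *)
Lemma quadratic_bounded_degree (R : numFieldType) (z : R) :
  algebraicOver (ratr : rat -> R) z ->
  exists E : nat, forall t mu y a b : R, ratalg z t -> mu ^+ 2 = t * mu - 1 ->
    ratalg z a -> ratalg z b -> y = a + b * mu ->
    exists f : {poly rat},
      [/\ f != 0, (size f <= E.+1)%N & root (map_poly ratr f) y].
Proof.
case=> q q0 qz; set d := size q; exists (d + d)%N => t mu y a b zt mu2 za zb Dy.
have yX i : exists a, exists b, [/\ ratalg z a, ratalg z b & y ^+ i = a + b * mu].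
  elim: i => [|i [a1 [b1 [za1 zb1 Di]]]].
    by exists 1, 0; rewrite expr0 mul0r addr0; split; [exact: ratalg1|exact: ratalg0|].
  exists (a * a1 + - (b * b1)), (a * b1 + b * a1 + b * b1 * t); split.
  - by apply: ratalgD; [|apply: ratalgN]; apply: ratalgM.
  - by do ?apply: ratalgD; do ?apply: ratalgM.
  - rewrite exprS Di Dy.
    transitivity (a * a1 + (a * b1 + b * a1) * mu + b * b1 * mu ^+ 2); first ring.
    by rewrite mu2; ring.
have yP (i : 'I_(d + d).+1) : exists AB : {poly rat} * {poly rat},
    [/\ (size AB.1 < d)%N, (size AB.2 < d)%N & y ^+ i =
      (map_poly ratr AB.1).[z] + (map_poly ratr AB.2).[z] * mu].
  have [a1 [b1 [[A ->] [B ->] ->]]] := yX i.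
  have [A' sA <-] := ratalg_small A q0 qz.
  by have [B' sB <-] := ratalg_small B q0 qz; exists (A', B').
have {yP} [AB yAB] := fin_all_exists yP.
pose CA := \matrix_(i < (d + d).+1, j < d) (AB i).1`_j.
pose CB := \matrix_(i < (d + d).+1, j < d) (AB i).2`_j.
(* The rows are the coordinates of the powers of [y]; there are more rows than columns, and a left
   kernel vector lists the coefficients of [f]. *)
have : kermx (row_mx CA CB) != 0.
  by rewrite kermx_eq0 /row_free neq_ltn ltnS rank_leq_col.
case/rowV0Pn => w /sub_kermxP; rewrite mul_mx_row -row_mx0 => /eq_row_mx[wA wB] w0.
have comb0 (P : 'I_(d + d).+1 -> {poly rat}) :
    w *m \matrix_(i < (d + d).+1, j < d) (P i)`_j = 0 -> (forall i, (size (P i) < d)%N) ->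
    \sum_i w 0 i *: P i = 0.
  move=> wP sP; apply/polyP => j; rewrite coef_sum coef0.
  have [jd|dj] := ltnP j d.
    have /rowP/(_ (Ordinal jd)) := wP; rewrite !mxE => E; rewrite -[RHS]E.
    by apply: eq_bigr => i _; rewrite coefZ mxE.
  apply: big1 => i _; rewrite coefZ nth_default ?mulr0//.
  exact: leq_trans (ltnW (sP i)) dj.
exists (\poly_(i < (d + d).+1) w 0 (inord i)); split.
- apply: contraNneq w0 => /polyP f0; apply/eqP/rowP => i; rewrite mxE.
  by have := f0 i; rewrite coef_poly ltn_ord coef0 inord_val.
- exact: size_poly.
- rewrite poly_def rmorph_sum /root horner_sum /=; apply/eqP.
  under eq_bigr => i _ do
    rewrite map_polyZ map_polyXn /= hornerZ hornerXn inord_val.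
  have -> : \sum_i ratr (w 0 i) * y ^+ i =
      (map_poly ratr (\sum_i w 0 i *: (AB i).1)).[z] +
      (map_poly ratr (\sum_i w 0 i *: (AB i).2)).[z] * mu.
    rewrite !rmorph_sum /= !horner_sum mulr_suml -big_split /=.
    apply: eq_bigr => i _; have [_ _ ->] := yAB i.
    by rewrite !map_polyZ !hornerZ mulrDr mulrA.
  by rewrite !comb0 ?rmorph0 ?horner0 ?mul0r ?addr0// => i; have [] := yAB i.
Qed.

(** * Commensurable eigenvalues *)

Lemma nth_root_gt1 (R : realType) (x : R) (n : nat) :
  1 < x -> (0 < n)%N -> exists2 y : R, 1 < y & y ^+ n = x.
Proof.
move=> x1 n0; have x0 : 0 < x by apply: lt_trans x1.
exists (expR (ln x / n%:R)).
  by rewrite expR_gt1 divr_gt0 ?ln_gt0 ?ltr0n.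
by rewrite -expRM_natl mulrC divfK ?pnatr_eq0 -?lt0n// lnK.
Qed.

Lemma pexprIn (R : realDomainType) (x y : R) (n : nat) : (0 < n)%N ->
  0 <= x -> 0 <= y -> x ^+ n = y ^+ n -> x = y.
Proof. by move=> n0 x0 y0 /eqP; rewrite eqrXn2// => /eqP. Qed.

Lemma bernoulli (R : realDomainType) (l : R) (n : nat) :
  1 <= l -> 1 + n%:R * (l - 1) <= l ^+ n.
Proof.
move=> l1; elim: n => [|n IHn]; first by rewrite mul0r addr0 expr0.
have : 1 <= l ^+ n by rewrite exprn_ege1.
by rewrite exprS -natr1; nra.
Qed.

Lemma expr_unbounded (R : realType) (l X : R) (n0 : nat) :
  1 < l -> exists2 n, (n0 <= n)%N & X < l ^+ n.
Proof.
move=> l1; pose m := Num.bound `|X / (l - 1)|; exists (n0 + m)%N; first exact: leq_addr.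
have lm : X < m%:R * (l - 1).
  by rewrite -ltr_pdivrMr ?subr_gt0// (le_lt_trans (ler_norm _))// archi_boundP.
have := bernoulli (n0 + m) (ltW l1); rewrite natrD.
have : 0 <= n0%:R :> R by [].
nra.
Qed.

(** Dividing [k] and [m] by their gcd gives coprime [N] and [M], and [y] is the [N]-th root of [l].
    The Bezout relation [M * a = 1 + N * b] then expresses [y] rationally in [l] and [mu], which
    later bounds its degree. *)
Lemma commensurable_root (R : realType) (l mu : R) (k m : nat) :
  1 < l -> 1 < mu -> (0 < k)%N -> (0 < m)%N -> mu ^+ k = l ^+ m ->
  exists N M a b : nat, exists y : R,
    [/\ (0 < N)%N, 1 < y, y ^+ N = l, y ^+ M = mu & y = mu ^+ a / l ^+ b].
Proof.
move=> l1 mu1 k0 m0 klm; have [l0 mu0] : 0 < l /\ 0 < mu by lra.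
set g := gcdn k m; have g0 : (0 < g)%N by rewrite gcdn_gt0 k0.
have [kE mE] : k = (k %/ g * g)%N /\ m = (m %/ g * g)%N.
  by rewrite !divnK ?dvdn_gcdl ?dvdn_gcdr.
set N := (k %/ g)%N in kE; set M := (m %/ g)%N in mE.
have N0 : (0 < N)%N by lia.
have M0 : (0 < M)%N by lia.
have coNM : gcdn M N = 1%N.
  by apply/eqP; rewrite -(eqn_pmul2r g0) mul1n muln_gcdl -kE -mE gcdnC.
have [y y1 yN] := nth_root_gt1 l1 N0; have y0 : 0 < y by lra.
have muN : mu ^+ N = l ^+ M.
  by apply: (@pexprIn _ _ _ g); rewrite ?exprn_ge0 ?ltW// -!exprM -kE -mE.
have yM : y ^+ M = mu.
  apply: (@pexprIn _ _ _ N); rewrite ?exprn_ge0 ?ltW//.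
  by rewrite exprAC yN muN.
case: (egcdnP N M0) => a b; rewrite coNM => ab _.
exists N, M, a, b, y; split => //.
rewrite -{1}yM -{1}yN -!exprM (_ : (M * a)%N = (1 + N * b)%N) ?exprD ?expr1; last by lia.
by rewrite mulfK// expf_neq0// gt_eqF.
Qed.

(** For transcendental [x] the equation is an identity of Laurent polynomials, so the top exponents
    agree: [h] on the left since [i < h], and [K + j] on the right since [K] and [j] are
    positive. *)
Lemma transcendental_exponents (R : numFieldType) (x : R) (K h i j : nat) :
  ~ algebraicOver (ratr : rat -> R) x -> x != 0 -> (0 < K)%N -> (i < h)%N ->
  x ^+ h + x ^- h + (x ^+ i + x ^- i) = (x ^+ K + x ^- K) * (x ^+ j + x ^- j) ->
  (i < j)%N -> h = (K + j)%N.
Proof.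
move=> xT x0 K0 ih E ij; apply: contrapT => hKj; apply: xT.
have [M hM] : exists M, (K + h + i + j <= M)%N by exists (K + h + i + j)%N.
(* This is [x ^+ M] times the difference of the two sides, with [M] large enough to clear the
   negative exponents. If [h] and [K + j] differ, the larger one carries a coefficient 1 or -1. *)
pose F : {poly rat} := 'X^(M + h) + 'X^(M - h) + ('X^(M + i) + 'X^(M - i))
  - ('X^(M + (K + j)) + 'X^(M - (K + j)) + ('X^(M + K - j) + 'X^(M + j - K))).
exists F.
  apply: contra_not_neq hKj => F0; apply/eqP.
  have /polyP F0' := F0.
  have [|hKj|//] := ltngtP h (K + j).
    move=> hKj; have := F0' (M + (K + j))%N; rewrite !(coefD, coefB, coefN, coefXn, coef0).
    have -> : (M + (K + j) == M + h)%N = false by lia.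
    have -> : (M + (K + j) == M - h)%N = false by lia.
    have -> : (M + (K + j) == M + i)%N = false by lia.
    have -> : (M + (K + j) == M - i)%N = false by lia.
    have -> : (M + (K + j) == M - (K + j))%N = false by lia.
    have -> : (M + (K + j) == M + K - j)%N = false by lia.
    have -> : (M + (K + j) == M + j - K)%N = false by lia.
    by rewrite eqxx.
  have := F0' (M + h)%N; rewrite !(coefD, coefB, coefN, coefXn, coef0).
  have -> : (M + h == M - h)%N = false by lia.
  have -> : (M + h == M + i)%N = false by lia.
  have -> : (M + h == M - i)%N = false by lia.
  have -> : (M + h == M + (K + j))%N = false by lia.
  have -> : (M + h == M - (K + j))%N = false by lia.
  have -> : (M + h == M + K - j)%N = false by lia.
  have -> : (M + h == M + j - K)%N = false by lia.
  by rewrite eqxx.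
have XB a b : (b <= M + a)%N -> x ^+ (M + a - b) = x ^+ M * (x ^+ a * x ^- b).
  move=> ba; rewrite mulrA -exprD -{2}(subnK ba) exprD mulfK// expf_neq0//.
have XB0 b : (b <= M)%N -> x ^+ (M - b) = x ^+ M * x ^- b.
  by move=> bM; rewrite -{1}[M]addn0 XB ?addn0// mul1r.
rewrite /root /F !(rmorphD, rmorphB, rmorphN) /= !map_polyXn.
rewrite !(hornerD, hornerN, hornerXn) !XB ?XB0; try lia.
rewrite !exprD !invfM; apply/eqP.
transitivity (x ^+ M * (x ^+ h + x ^- h + (x ^+ i + x ^- i)
  - (x ^+ K + x ^- K) * (x ^+ j + x ^- j))); first ring.
by rewrite E subrr mulr0.
Qed.

Lemma algebraic_exp (F E : fieldType) (f : {rmorphism F -> E}) (x : E) (n : nat) :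
  algebraicOver f x -> algebraicOver f (x ^+ n).
Proof.
move=> xA; elim: n => [|n IHn]; first exact: algebraic1.
by rewrite exprS; apply: algebraic_mul.
Qed.

Lemma algebraic_expI (F E : fieldType) (f : {rmorphism F -> E}) (x : E) (n : nat) :
  (0 < n)%N -> algebraicOver f (x ^+ n) -> algebraicOver f x.
Proof.
move=> n0 [p p0 px]; exists (p \Po 'X^n); first by rewrite comp_poly_eq0 ?size_polyXn.
by rewrite map_comp_poly map_polyXn /root horner_comp hornerXn.
Qed.

Lemma algebraic_int_root (R : numFieldType) (x : R) :
  algebraicOver (ratr : rat -> R) x ->
  exists2 g : {poly int}, g != 0 & root (map_poly intr g) x.
Proof.
case=> f f0 fx; have [g [a a0 Df]] := rat_poly_scale f; exists g.
  by apply: contraNneq f0 => g0; rewrite Df g0 map_poly0 scaler0.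
move: fx; rewrite Df map_polyZ rootZ ?fmorph_eq0 ?invr_eq0 ?intr_eq0//.
by rewrite -map_poly_comp (@eq_map_poly _ _ _ intr)// => z /=; rewrite ratr_int.
Qed.

Lemma quadratic_power (R : numFieldType) (z t mu : R) (a : nat) :
  ratalg z t -> mu ^+ 2 = t * mu - 1 ->
  exists A B : R, [/\ ratalg z A, ratalg z B & mu ^+ a = A + B * mu].
Proof.
move=> zt mu2; elim: a => [|a [A [B [zA zB Da]]]].
  by exists 1, 0; rewrite mul0r addr0; split; [exact: ratalg1|exact: ratalg0|].
exists (- B), (A + B * t); split; [exact: ratalgN|by apply: ratalgD => //; apply: ratalgM|].
transitivity (A * mu + B * mu ^+ 2); first by rewrite exprS Da; ring.
by rewrite mu2; ring.
Qed.

(* t_(n+1) - l t_n = - (l - 1/l) s / l^n, whereas mu_(n+1) = l mu_n forces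
   t_(n+1) - l t_n = - (l - 1/l) / mu_n. *)
Lemma eigenvalue_shift (R : fieldType) (l p s a : R) (n : nat) :
  l != 0 -> l ^+ 2 != 1 -> a != 0 ->
  a + a^-1 = l ^+ n * p + s / l ^+ n ->
  l * a + (l * a)^-1 = l ^+ n.+1 * p + s / l ^+ n.+1 -> p * s = 1.
Proof.
move=> l0 l21 a0; rewrite exprS.
have : l ^+ n != 0 by rewrite expf_neq0.
set L := l ^+ n => L0 E1 E2.
(* In [l] times the first equation minus the second, both sides have the factor [l - l^-1];
   cancelling it leaves [a^-1 = s / L]. *)
have sa : s * a = L.
  apply/eqP; rewrite -subr_eq0; have : (l ^+ 2 - 1) * (s * a - L) = 0.
    transitivity (l * a * L * ((l * (a + a^-1) - (l * a + (l * a)^-1))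
      - (l * (L * p + s / L) - (l * L * p + s / (l * L)))) * -1).
      by field; rewrite a0 l0 L0.
    by rewrite E1 E2; ring.
  by move/eqP; rewrite mulf_eq0 (subr_eq0 _ 1) (negPf l21).
have s0 : s != 0 by apply: contraNneq L0 => s0; rewrite -sa s0 mul0r.
have La : s / L = a^-1 by rewrite -sa invfM mulrA mulfV ?mul1r.
move: E1; rewrite La => /addIr; rewrite -sa => E1.
by apply: (mulIf a0); rewrite mul1r {2}E1; ring.
Qed.

(** * Sequences of traces whose eigenvalues are all commensurable with [l] *)

Section CommensurableTraces.
Variables (R : realType) (l p s : R) (n0 : nat) (mu : nat -> R).
Hypotheses (l1 : 1 < l) (p0 : 0 < p).
Hypothesis mu_gt1 : forall n, (n0 <= n)%N -> 1 < mu n.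
Hypothesis mu_tr : forall n, (n0 <= n)%N ->
  mu n + (mu n)^-1 = l ^+ n * p + s / l ^+ n.
Hypothesis mu_comm : forall n, (n0 <= n)%N ->
  exists k m : nat, [/\ (0 < k)%N, (0 < m)%N & mu n ^+ k = l ^+ m].

(** By [mu_near], [mu n] differs from [l ^+ n * p] by at most [1 + |s|]; the errors at [n.+1] and,
    multiplied by [l], at [n] add up to [C]. *)
Let C := (1 + l) * (1 + `|s|).

Let mu_near n : (n0 <= n)%N -> `|mu n - l ^+ n * p| <= 1 + `|s|.
Proof.
move=> n0n; have E := mu_tr n0n; have mu1 := mu_gt1 n0n.
have -> : mu n - l ^+ n * p = s / l ^+ n - (mu n)^-1 by lra.
apply: (le_trans (ler_normB _ _)); rewrite addrC lerD//.
  by rewrite gtr0_norm ?invr_gt0 ?invf_le1; lra.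
have L1 : 1 <= l ^+ n by rewrite exprn_ege1// ltW.
by rewrite normrM normfV (@ger0_norm _ (l ^+ n)) ?ler_piMr// ?invf_le1; lra.
Qed.

Let mu_shift n : (n0 <= n)%N -> `|mu n.+1 - l * mu n| <= C.
Proof.
move=> n0n; have l0 : 0 < l by apply: lt_trans l1.
have -> : mu n.+1 - l * mu n =
    (mu n.+1 - l ^+ n.+1 * p) - l * (mu n - l ^+ n * p) by rewrite exprS; ring.
apply: (le_trans (ler_normB _ _)); rewrite /C mulrDl mul1r normrM gtr0_norm//.
by apply: lerD; [exact/mu_near/leqW|rewrite ler_pM2l//; exact: mu_near].
Qed.

Let mu_unbounded X : exists2 n, (n0 <= n)%N & X < mu n.
Proof.
have [n n0n Xn] := expr_unbounded ((X + 1 + `|s|) / p) n0 l1; exists n => //.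
have := mu_near n0n; rewrite ler_norml => /andP[a1 _].
by move: Xn; rewrite ltr_pdivrMr//; lra.
Qed.

Let mu_increasing n : (n0 <= n)%N -> C / (l - 1) < mu n -> mu n < mu n.+1.
Proof.
move=> n0n; rewrite ltr_pdivrMr ?subr_gt0// => Xn.
by have := mu_shift n0n; rewrite ler_norml => /andP[a1 _]; lra.
Qed.

Lemma shift_of_transcendental : ~ algebraicOver (ratr : rat -> R) l ->
  exists2 n, (n0 <= n)%N & mu n.+1 = l * mu n.
Proof.
move=> lT; have [n n0n Xn] := mu_unbounded (C / (l - 1)).
have n1n : (n0 <= n.+1)%N by rewrite leqW.
have n2n : (n0 <= n.+2)%N by rewrite leqW.
exists n.+1 => //.
have lt1 := mu_increasing n0n Xn; have lt2 := mu_increasing n1n (lt_trans Xn lt1).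
have [k1 [m1 [k10 m10 E1]]] := mu_comm n0n.
have [k2 [m2 [k20 m20 E2]]] := mu_comm n1n.
have [k3 [m3 [k30 m30 E3]]] := mu_comm n2n.
have K0 : (0 < k1 * k2 * k3)%N by rewrite !muln_gt0 k10 k20.
(* One root [x] of [l] of which all three eigenvalues are powers; the order of the eigenvalues
   becomes that of the exponents. *)
have [x x1 xK] := nth_root_gt1 l1 K0.
have x0 : 0 <= x by lra.
have := mu_gt1 n0n => g1; have := mu_gt1 n1n => g2; have := mu_gt1 n2n => g3.
have D1 : mu n = x ^+ (k2 * k3 * m1).
  apply: (pexprIn k10); rewrite ?exprn_ge0//; first lra.
  by rewrite E1 -xK -!exprM; congr (_ ^+ _); ring.
have D2 : mu n.+1 = x ^+ (k1 * k3 * m2).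
  apply: (pexprIn k20); rewrite ?exprn_ge0//; first lra.
  by rewrite E2 -xK -!exprM; congr (_ ^+ _); ring.
have D3 : mu n.+2 = x ^+ (k1 * k2 * m3).
  apply: (pexprIn k30); rewrite ?exprn_ge0//; first lra.
  by rewrite E3 -xK -!exprM; congr (_ ^+ _); ring.
move: lt1 lt2; rewrite D1 D2 D3 !ltr_eXn2l// => lt1 lt2.
rewrite -xK -exprD; congr (_ ^+ _).
apply: (@transcendental_exponents _ x _ _ (k2 * k3 * m1)) => //.
- by move=> /(algebraic_exp (k1 * k2 * k3)); rewrite xK.
- by rewrite gt_eqF//; lra.
- exact: ltn_trans lt1 lt2.
(* What remains is the recurrence of the traces, with [l + l^-1] as multiplier. *)
rewrite -D1 -D2 -D3 xK !mu_tr// !exprS.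
have l0 : l != 0 by rewrite gt_eqF// (lt_trans _ l1).
have := expf_neq0 n l0; move: (l ^+ n) => L L0.
by field; rewrite L0.
Qed.

Lemma shift_of_algebraic : algebraicOver (ratr : rat -> R) l ->
  exists2 n, (n0 <= n)%N & mu n.+1 = l * mu n.
Proof.
move=> lA; have l0 : l != 0 by rewrite gt_eqF// (lt_trans _ l1).
have muA n : (n0 <= n)%N -> algebraicOver (ratr : rat -> R) (mu n).
  move=> /mu_comm[k [m [k0 _ E]]]; apply: (algebraic_expI k0).
  by rewrite E; apply: algebraic_exp.
pose t n := mu n + (mu n)^-1.
have tA n : (n0 <= n)%N -> algebraicOver (ratr : rat -> R) (t n).
  by move=> n0n; apply: algebraic_add; [|apply: algebraic_inv]; apply: muA.
(* These four numbers suffice: the recurrence of the traces puts every later [t n] into Q[z]. *)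
have [|z zA zs] := @algebraic_primitive R [:: l; l^-1; t n0; t n0.+1].
  move=> x; rewrite !inE => /or4P[]/eqP->//; [exact: algebraic_inv|exact: tA|].
  exact/tA/leqW.
have zl : ratalg z l by apply: zs; rewrite !inE eqxx.
have zl' : ratalg z l^-1 by apply: zs; rewrite !inE eqxx !orbT.
have zt n : (n0 <= n)%N -> ratalg z (t n).
  suff zt2 m : ratalg z (t (n0 + m)%N) /\ ratalg z (t (n0 + m).+1).
    by move=> /subnKC <-; have [] := zt2 (n - n0)%N.
  elim: m => [|m [IH1 IH2]].
    by rewrite addn0; split; apply: zs; rewrite !inE eqxx !orbT.
  rewrite addnS; split=> //; have nm : (n0 <= n0 + m)%N := leq_addr _ _.
  have -> : t (n0 + m).+2 = (l + l^-1) * t (n0 + m).+1 - t (n0 + m)%N.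
    rewrite /t !mu_tr//; try by do 2?apply: leqW.
    rewrite !exprS; have := expf_neq0 (n0 + m) l0; move: (l ^+ _) => L L0.
    by field; rewrite L0.
  apply: ratalgD; last exact: ratalgN.
  by apply: ratalgM => //; apply: ratalgD.
have [E Eprop] := quadratic_bounded_degree zA.
have [g g0 gl] := algebraic_int_root lA.
have [d d0 dprop] := root_near_one R E g0.
(* From [1 + d <= y] and [y ^+ N = l], Bernoulli's inequality gives [N * d <= l]. Hence the
   factorial of [N0] is a common multiple of all denominators [N] that occur. *)
pose N0 := Num.bound (l / d).
have muF n : (n0 <= n)%N -> exists m, mu n ^+ N0`! = l ^+ m.
  move=> n0n; have mu1 := mu_gt1 n0n; have [k [m [k0 m0 Ekm]]] := mu_comm n0n.
  have [N [M [a [b [y [N1 y1 yN yM Dy]]]]]] := commensurable_root l1 mu1 k0 m0 Ekm.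
  have mu2 : mu n ^+ 2 = t n * mu n - 1 by rewrite /t; field; rewrite gt_eqF//; lra.
  have [A [B [zA' zB Da]]] := quadratic_power a (zt _ n0n) mu2.
  have zb : ratalg z (l ^- b).
    rewrite -exprVn; elim: b {Dy} => [|b IHb]; first exact: ratalg1.
    by rewrite exprS; apply: ratalgM.
  have [|f [f0 sf fy]] := Eprop _ _ y _ _ (zt _ n0n) mu2 (ratalgM zA' zb) (ratalgM zB zb).
    by rewrite Dy Da; ring.
  have gy : root (map_poly intr g) (y ^+ N) by rewrite yN.
  have dy := dprop N y f N1 y1 f0 sf fy gy.
  have NN0 : (N <= N0)%N.
    rewrite ltnW// -(ltr_nat R); apply: le_lt_trans (archi_boundP _); last first.
      by rewrite divr_ge0 // ltW // (lt_trans _ l1).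
    rewrite ler_pdivlMr// -yN; apply: le_trans (_ : (1 + d) ^+ N <= _).
      have : 1 <= 1 + d by lra.
      by move/(bernoulli N); rewrite [1 + d]addrC addrK; apply: le_trans; rewrite lerDr.
    by rewrite lerXn2r// ?nnegrE; lra.
  exists (M * (N0`! %/ N))%N.
  rewrite -yM -yN -!exprM; congr (_ ^+ _).
  have /divnK : (N %| N0`!)%N by rewrite dvdn_fact// N1.
  by move=> {1}<-; ring.
have F0 : (0 < N0`!)%N := fact_gt0 N0; set F := N0`! in F0 muF.
have [r r1 rF] := nth_root_gt1 l1 F0.
have lgt0 : 0 < l by apply: lt_trans l1.
have rl : 0 < (r - 1) * l by rewrite mulr_gt0// subr_gt0.
(* The threshold makes [C * r < (r - 1) * l * mu n], so [mu n.+1] and [l * mu n] differ by a factor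
   strictly between [r^-1] and [r]. Their [F]-th powers are powers of [l] whose ratio lies strictly
   between [l^-1] and [l], so they coincide. *)
have [n n0n Xn] := mu_unbounded (C * r / ((r - 1) * l)).
exists n => //; have n1n : (n0 <= n.+1)%N by rewrite leqW.
have [m Dm] := muF _ n0n; have [m' Dm'] := muF _ n1n.
have mu1 := mu_gt1 n0n; have mu1' := mu_gt1 n1n.
have lmu0 : 0 < l * mu n by rewrite mulr_gt0//; lra.
have := mu_shift n0n; rewrite ler_norml => /andP[a1 a2].
have C0 : 0 <= C by rewrite mulr_ge0//; have := normr_ge0 s; lra.
move: Xn; rewrite ltr_pdivrMr// => Xn.
have CrC : C <= C * r by rewrite ler_peMr// ltW.
have b1 : mu n.+1 < r * (l * mu n) by lra.
have b2 : l * mu n < r * mu n.+1.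
  have : r * (l * mu n - C) <= r * mu n.+1 by rewrite ler_pM2l; lra.
  lra.
have lmF : (l * mu n) ^+ F = l ^+ (F + m) by rewrite exprMn Dm exprD.
apply: (pexprIn F0); rewrite ?lmF ?Dm'; [lra|exact: ltW|congr (_ ^+ _)].
have rX x : l * x ^+ F = (r * x) ^+ F by rewrite exprMn rF.
have leX n1 n2 : l ^+ n1 < l * l ^+ n2 -> (n1 <= n2)%N.
  by rewrite -exprS ltr_eXn2l.
apply/eqP; rewrite eqn_leq; apply/andP; split; apply: leX; rewrite -lmF -Dm'.
  by rewrite rX ltrXn2r -?lt0n ?nnegrE ?mulr_ge0//; lra.
by rewrite rX ltrXn2r -?lt0n ?nnegrE ?mulr_ge0//; lra.
Qed.

Lemma commensurable_traces : p * s = 1.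
Proof.
have l0 : l != 0 by rewrite gt_eqF// (lt_trans _ l1).
have [n n0n E] : exists2 n, (n0 <= n)%N & mu n.+1 = l * mu n.
  case: (pselect (algebraicOver (ratr : rat -> R) l)).
    exact: shift_of_algebraic.
  exact: shift_of_transcendental.
apply: (@eigenvalue_shift _ l p s (mu n) n) => //.
- by rewrite gt_eqF// expr2 mulr_egt1.
- by rewrite gt_eqF// (lt_trans _ (mu_gt1 n0n)).
- exact: mu_tr.
- by rewrite -E mu_tr// leqW.
Qed.

End CommensurableTraces.

(** * Matrices of size 2 *)

Lemma ord2_cases (P : 'I_2 -> Prop) : P 0 -> P 1 -> forall i, P i.
Proof.
move=> P0 P1 [[|[|i]] i2] //.
  by have -> : Ordinal i2 = 0 by apply: val_inj.
by have -> : Ordinal i2 = 1 by apply: val_inj.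
Qed.

Definition mx2 (R : nzRingType) (a b c d : R) : 'M[R]_2 :=
  \matrix_(i, j) (if i == 0 then if j == 0 then a else b
                  else if j == 0 then c else d).

Section Matrix2.
Variable R : comUnitRingType.
Implicit Types a b c d : R.

Lemma mx2_ext (A B : 'M[R]_2) : A 0 0 = B 0 0 -> A 0 1 = B 0 1 ->
  A 1 0 = B 1 0 -> A 1 1 = B 1 1 -> A = B.
Proof.
by move=> *; apply/matrixP; apply: ord2_cases; apply: ord2_cases.
Qed.

Lemma mx2E (A : 'M[R]_2) : A = mx2 (A 0 0) (A 0 1) (A 1 0) (A 1 1).
Proof. by apply: mx2_ext; rewrite mxE. Qed.

Lemma mx2_mul a b c d a' b' c' d' : mx2 a b c d * mx2 a' b' c' d' =
  mx2 (a * a' + b * c') (a * b' + b * d') (c * a' + d * c') (c * b' + d * d').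
Proof.
by apply: mx2_ext; rewrite /mx2 !mxE !big_ord_recl big_ord0 !mxE /= addr0.
Qed.

Lemma mx2_opp a b c d : - mx2 a b c d = mx2 (- a) (- b) (- c) (- d).
Proof. by apply: mx2_ext; rewrite !mxE. Qed.

Lemma mx2_1 : mx2 1 0 0 1 = 1 :> 'M[R]_2.
Proof. by apply: mx2_ext; rewrite !mxE. Qed.

Lemma mx2_tr a b c d : \tr (mx2 a b c d) = a + d.
Proof. by rewrite /mxtrace !big_ord_recl big_ord0 !mxE /= addr0. Qed.

Lemma mx2_det a b c d : \det (mx2 a b c d) = a * d - b * c.
Proof.
rewrite (expand_det_row _ 0) !big_ord_recl big_ord0 addr0 /cofactor !det_mx11.
by rewrite !mxE /= expr0 expr1; ring.
Qed.

Lemma mx2_unit a b c d : mx2 a b c d \is a GRing.unit = (a * d - b * c \is a GRing.unit).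
Proof. by rewrite -[LHS]/(_ \in unitmx) unitmxE mx2_det. Qed.

Lemma mx2_inv a b c d : a * d - b * c = 1 -> (mx2 a b c d)^-1 = mx2 d (- b) (- c) a.
Proof.
move=> D; have u : mx2 a b c d \is a GRing.unit by rewrite mx2_unit D unitr1.
apply: (mulrI u); rewrite mulrV// mx2_mul -mx2_1; congr mx2; by [ring|rewrite -D; ring].
Qed.

Lemma mx2_inj a b c d a' b' c' d' : mx2 a b c d = mx2 a' b' c' d' ->
  [/\ a = a', b = b', c = c' & d = d'].
Proof.
move=> /matrixP E; have := E 0 0; have := E 0 1; have := E 1 0; have := E 1 1.
by rewrite !mxE.
Qed.

End Matrix2.

Section Matrix2Powers.
Variable R : fieldType.

Lemma mx2_unipotentX (x : R) (z : int) : mx2 1 x 0 1 ^ z = mx2 1 (z%:~R * x) 0 1.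
Proof.
have posX (n : nat) : mx2 1 x 0 1 ^+ n = mx2 1 (n%:R * x) 0 1.
  elim: n => [|n IHn]; first by rewrite expr0 mul0r mx2_1.
  by rewrite exprS IHn mx2_mul; congr mx2; rewrite -?natr1; ring.
case: z => n; first by rewrite -exprnP posX.
rewrite NegzE -exprnN posX mx2_inv; last by ring.
by congr mx2; rewrite ?oppr0// mulrNz mulNr.
Qed.

Lemma mx2_diagX (x : R) (z : int) : x != 0 ->
  mx2 x 0 0 x^-1 ^ z = mx2 (x ^ z) 0 0 (x ^ z)^-1.
Proof.
move=> x0; have posX (n : nat) : mx2 x 0 0 x^-1 ^+ n = mx2 (x ^+ n) 0 0 (x ^- n).
  elim: n => [|n IHn]; first by rewrite !expr0 invr1 mx2_1.
  by rewrite exprS IHn mx2_mul exprS invfM; congr mx2; ring.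
case: z => n; first by rewrite -!exprnP posX.
rewrite NegzE -!exprnN posX mx2_inv ?invrK ?oppr0// mulr0 subr0 divff//.
by rewrite expf_neq0.
Qed.

End Matrix2Powers.

(** The generator is the least positive element. It exists because distinct elements are at least
    [e] apart, so an element within [e] of the infimum attains it; division with remainder does the
    rest. Without positive elements the generator is 0. *)
Lemma discrete_additive_cyclic (R : realType) (D : set R) (e : R) :
  0 < e -> D 0 -> (forall x y, D x -> D y -> D (x - y)) ->
  (forall x, D x -> `|x| < e -> x = 0) ->
  exists2 g, D g & forall x, D x -> exists z : int, x = z%:~R * g.
Proof.
move=> e0 D0 DB De.
have DN x : D x -> D (- x) by move=> Dx; rewrite -sub0r; apply: DB.
have DM x (z : int) : D x -> D (z%:~R * x).
  move=> Dx; have DMn (n : nat) : D (n%:R * x).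
    elim: n => [|n IHn]; first by rewrite mul0r.
    by rewrite -natr1 mulrDl mul1r -[x in _ + x]opprK; apply: DB => //; apply: DN.
  by case: z => n; [exact: DMn|rewrite NegzE mulrNz mulNr]; apply/DN/DMn.
pose P := [set x | D x /\ 0 < x].
have [[x0 [Dx0 x00]]|noP] := pselect (exists x, P x); last first.
  exists 0 => // x Dx; exists 0; rewrite mulr0; apply: contrapT => /eqP.
  case: ltgtP => // x0 _; apply: noP; last by exists x.
  by exists (- x); split; [exact: DN|rewrite oppr_gt0].
have Pinf : has_inf P by split; [exists x0|exists 0 => x [_ /ltW]].
have [g [Dg g0] gP] := @inf_adherent _ P e e0 Pinf.
have gmin x : P x -> g <= x.
  move=> Px; rewrite leNgt; apply/negP => xg; have [Dx _] := Px.
  have infx : inf P <= x by apply: ge_inf => //; case: Pinf.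
  have : g - x = 0 by apply: De; [exact: DB|rewrite gtr0_norm ?subr_gt0//; lra].
  by lra.
exists g => // x Dx; exists (Num.floor (x / g)).
set z := Num.floor _; have Dy := DB _ _ Dx (DM _ z Dg).
have /andP[z1 z2] : z%:~R <= x / g < z%:~R + 1.
  by rewrite -intrD1 floor_itv// num_real.
move: z1 z2; rewrite ler_pdivlMr// ltr_pdivrMr// => z1 z2.
apply/eqP; rewrite -subr_eq0; apply: contraT => y0.
have : P (x - z%:~R * g) by split=> //; rewrite lt_neqAle eq_sym y0 subr_ge0.
by move/gmin; lra.
Qed.

(** * Discrete matrix groups *)

Definition conj_set (R : comUnitRingType) n (P : 'M[R]_n.+1) (T : set 'M[R]_n.+1) :
    set 'M[R]_n.+1 :=
  [set P * A * P^-1 | A in T].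

Definition near_id (R : realType) (e : R) : set 'M[R]_2 :=
  [set A | forall i j, `|A i j - (i == j)%:R| < e].

(* T stands for the preimage in SL2 of a discrete subgroup of PSL2, up to
   conjugation. *)
Record matrix_group (R : realType) (T : set 'M[R]_2) : Prop := MatrixGroup {
  mg_det : forall A, T A -> \det A = 1;
  mgM : forall A B, T A -> T B -> T (A * B);
  mgV : forall A, T A -> T A^-1;
  mg1 : T 1;
  mgN : forall A, T A -> T (- A);
  mg_discrete : exists2 e : R, 0 < e & forall A, T A -> near_id e A -> A = 1 }.

(** Up to a sign, which dies in PSL2, finitely many left translates of the powers of [g] cover [T].
    The matrices in [cs] may lie outside [T]. *)
Definition matrix_elementary (R : realType) (T : set 'M[R]_2) : Prop :=
  exists (g : 'M[R]_2) (cs : seq 'M[R]_2), T g /\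
    forall A, T A -> exists c (b : bool) (z : int),
      c \in cs /\ A = (-1) ^+ b *: (c * g ^ z).

(** Phrased by traces, the condition is visibly invariant under conjugation; [x] and [y] are the
    eigenvalues greater than 1, and the translation lengths are [2 * ln x] and [2 * ln y]. *)
Definition traces_commensurable (R : realType) (T : set 'M[R]_2) : Prop :=
  forall A B (x y : R), T A -> T B -> 1 < x -> 1 < y ->
    \tr A = x + x^-1 -> \tr B = y + y^-1 ->
    exists k m : nat, [/\ (0 < k)%N, (0 < m)%N & y ^+ k = x ^+ m].

Lemma near_id_mx2 (R : realType) (e a b c d : R) :
  `|a - 1| < e -> `|b| < e -> `|c| < e -> `|d - 1| < e -> near_id e (mx2 a b c d).
Proof.
move=> a1 b1 c1 d1; rewrite /near_id /=.
by apply: ord2_cases; apply: ord2_cases; rewrite !mxE /= ?subr0.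
Qed.

Lemma sub1mxE (R : nzRingType) n (A : 'M[R]_n.+1) i j :
  (A - 1) i j = A i j - (i == j)%:R.
Proof. by rewrite !mxE. Qed.

Lemma mxtrace_conj (R : comUnitRingType) n (P A : 'M[R]_n.+1) :
  P \is a GRing.unit -> \tr (P * A * P^-1) = \tr A.
Proof. by move=> Pu; rewrite -mulmxE mxtrace_mulC mulmxE mulrA mulVr// mul1r. Qed.

(** * Invariance under conjugation *)

Section Conjugation.
Variables (R : realType) (P : 'M[R]_2) (T : set 'M[R]_2).
Hypothesis Pu : P \is a GRing.unit.

Lemma conj_mulmx (A B : 'M[R]_2) : P * A * P^-1 * (P * B * P^-1) = P * (A * B) * P^-1.
Proof. by rewrite !mulrA mulrVK. Qed.

Lemma conj_near_id (e : R) : 0 < e -> exists2 d, 0 < d &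
  forall A, near_id d (P * A * P^-1) -> near_id e A.
Proof.
move=> e0; pose N (A : 'M[R]_2) := \sum_i \sum_j `|A i j|.
have N0 A : 0 <= N A by do 2![apply: sumr_ge0 => ? _].
have Nle (A : 'M[R]_2) i j : `|A i j| <= N A.
  rewrite /N (bigD1 i)//= (bigD1 j)//= -addrA lerDl addr_ge0// ?sumr_ge0// => ? _.
  by apply: sumr_ge0.
(* An entry of [P^-1 * B * P] is a sum of four products, each at most [d * (N P^-1 * N P)]; the
   summand 1 keeps the denominator positive. *)
pose d := e / (1 + (N P^-1 * N P) *+ 4).
have d1 : 0 < 1 + (N P^-1 * N P) *+ 4 by rewrite ltr_pwDl// mulrn_wge0// mulr_ge0.
exists d => [|A nA i j]; first by rewrite divr_gt0.
have -> : A i j - (i == j)%:R = (A - 1) i j by rewrite sub1mxE.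
have -> : A - 1 = P^-1 * (P * A * P^-1 - 1) * P.
  by rewrite mulrBr mulr1 mulrBl !mulrA mulVr// mul1r mulrVK.
set B := _ - 1.
have Bd k m : `|B k m| <= d by rewrite sub1mxE; apply/ltW/nA.
have -> : e = d * (1 + (N P^-1 * N P) *+ 4) by rewrite divfK// gt_eqF.
have d0 : 0 < d by rewrite divr_gt0.
apply: (@le_lt_trans _ _ (d * ((N P^-1 * N P) *+ 4))); last by rewrite ltr_pM2l// ltrDr.
have -> : d * ((N P^-1 * N P) *+ 4) = \sum_(k < 2) \sum_(m < 2) d * (N P^-1 * N P).
  by rewrite !big_ord_recl !big_ord0; ring.
rewrite -mulmxE mxE; apply: (le_trans (ler_norm_sum _ _ _)); apply: ler_sum => k _.
rewrite mxE mulr_suml; apply: (le_trans (ler_norm_sum _ _ _)).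
apply: ler_sum => m _; rewrite !normrM [_ * `|B _ _|]mulrC -mulrA.
by rewrite ler_pM ?mulr_ge0 ?ler_pM.
Qed.

Lemma conj_invr (A : 'M[R]_2) : (P * A * P^-1)^-1 = P * A^-1 * P^-1.
Proof.
have [Au|Au] := boolP (A \is a GRing.unit).
  by rewrite invrM ?unitrV ?unitrMl// invrK invrM// mulrA.
by rewrite (invr_out Au); apply: invr_out; rewrite unitrMl ?unitrV// unitrMr.
Qed.

Lemma conj_matrix_group : matrix_group T -> matrix_group (conj_set P T).
Proof.
move=> [TD TM TV T1 TN [e e0 Te]]; split.
- by move=> _ [A TA <-]; rewrite -!mulmxE !det_mulmx (TD _ TA) mulr1 -det_mulmx mulmxV ?det1.
- move=> _ _ [A TA <-] [B TB <-]; exists (A * B); first exact: TM.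
  by rewrite conj_mulmx.
- move=> _ [A TA <-]; exists A^-1; first exact: TV.
  by rewrite conj_invr.
- by exists 1; rewrite // mulr1 mulrV.
- by move=> _ [A TA <-]; exists (- A); [exact: TN|rewrite mulrN mulNr].
- have [d d0 dP] := conj_near_id e0; exists d => // _ [A TA <-] /dP /(Te _ TA) ->.
  by rewrite mulr1 mulrV.
Qed.

Lemma conj_elementary : matrix_elementary (conj_set P T) -> matrix_elementary T.
Proof.
move=> [_ [cs [[g Tg <-] gP]]].
exists g, [seq P^-1 * c * P | c <- cs]; split => // A TA.
have [|c [b [z [ccs Ez]]]] := gP (P * A * P^-1); first by exists A.
exists (P^-1 * c * P), b, z; split; first exact: map_f.
have -> : A = P^-1 * (P * A * P^-1) * P by rewrite !mulrA mulVr// mul1r mulrVK.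
rewrite Ez -scalerAr -scalerAl; congr (_ *: _).
have -> : (P * g * P^-1) ^ z = P * g ^ z * P^-1.
  have posX (h : 'M[R]_2) (n : nat) : (P * h * P^-1) ^+ n = P * h ^+ n * P^-1.
    elim: n => [|n IHn]; first by rewrite !expr0 mulr1 mulrV.
    by rewrite !exprS IHn conj_mulmx.
  case: z {Ez} => n; first by rewrite -!exprnP posX.
  by rewrite NegzE -!exprnN posX conj_invr.
by rewrite !mulrA mulrVK.
Qed.

Lemma conj_traces : traces_commensurable T -> traces_commensurable (conj_set P T).
Proof.
by move=> Tc _ _ x y [A TA <-] [B TB <-]; rewrite !mxtrace_conj//; apply: Tc TA TB.
Qed.

End Conjugation.

(** * Groups with a unipotent element and without hyperbolic ones *)

Section Parabolic.
Variables (R : realType) (T : set 'M[R]_2).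
Hypothesis TG : matrix_group T.

Let T_det a b c d : T (mx2 a b c d) -> a * d - b * c = 1.
Proof. by move=> /(mg_det TG); rewrite mx2_det. Qed.

(* The trace of u ^ n * A is tr A + n x c, which is unbounded unless c = 0. *)
Lemma parabolic_triangular (x a b c d : R) :
  (forall A, T A -> `|\tr A| <= 2) -> x != 0 -> T (mx2 1 x 0 1) ->
  T (mx2 a b c d) -> c = 0.
Proof.
move=> tr2 x0 Tu TA; apply: contrapT => /eqP c0.
pose n := Num.bound ((2 + `|a + d|) / `|x * c|).
have Tun m : T (mx2 1 (m%:R * x) 0 1).
  elim: m => [|m IHm]; first by rewrite mul0r mx2_1; exact: mg1 TG.
  have := mgM TG Tu IHm; rewrite mx2_mul; congr (T (mx2 _ _ _ _)); rewrite -?natr1; ring.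
have := tr2 _ (mgM TG (Tun n) TA); rewrite mx2_mul mx2_tr.
have xc0 : 0 < `|x * c| by rewrite normr_gt0 mulf_neq0.
have : (2 + `|a + d|) / `|x * c| < n%:R.
  by rewrite archi_boundP// divr_ge0 ?addr_ge0// ltW.
rewrite ltr_pdivrMr// => nbig.
have -> : 1 * a + n%:R * x * c + (0 * b + 1 * d) = n%:R * (x * c) + (a + d) by ring.
have := lerB_normD (n%:R * (x * c)) (a + d); rewrite normrM normr_nat.
lra.
Qed.

(** All elements are upper triangular by [parabolic_triangular], and the trace bound makes them
    unipotent up to sign. Their upper right entries form a discrete, hence cyclic, subgroup of the
    reals. *)
Lemma parabolic_elementary (x : R) :
  (forall A, T A -> `|\tr A| <= 2) -> x != 0 -> T (mx2 1 x 0 1) ->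
  matrix_elementary T.
Proof.
move=> tr2 x0 Tu; have [e e0 Te] := mg_discrete TG.
pose D : set R := [set y | T (mx2 1 y 0 1)].
have D0 : D 0 by rewrite /D/= mx2_1; exact: mg1 TG.
have DB y z : D y -> D z -> D (y - z).
  move=> Dy Dz; have := mgM TG Dy (mgV TG Dz); rewrite mx2_inv ?mx2_mul; last ring.
  by rewrite /D/=; congr (T (mx2 _ _ _ _)); ring.
have De y : D y -> `|y| < e -> y = 0.
  move=> Dy ye; suff : mx2 1 y 0 1 = 1 by rewrite -mx2_1 => /mx2_inj[].
  by apply: Te => //; apply: near_id_mx2; rewrite ?subrr ?normr0.
have [g Dg gD] := discrete_additive_cyclic e0 D0 DB De.
exists (mx2 1 g 0 1), [:: 1]; split => // A TA; exists 1.
rewrite (mx2E A) in TA *; move: (A 0 0) (A 0 1) (A 1 0) (A 1 1) TA => a b c d TA.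
have c0 := parabolic_triangular tr2 x0 Tu TA; rewrite {}c0 in TA *.
have := T_det TA; have := tr2 _ TA; rewrite mx2_tr mulr0 subr0 => ad2 ad1.
(* Here [(a - d) ^+ 2 = (a + d) ^+ 2 - 4] is at most 0. *)
have ad : a = d.
  apply/eqP; rewrite -subr_eq0 -sqrf_eq0 eq_le sqr_ge0 andbT.
  by move: ad2; rewrite ler_norml => /andP[? ?]; nra.
have : a ^+ 2 = 1 by rewrite expr2 {2}ad.
move/eqP; rewrite sqrf_eq1 => /orP[]/eqP a1; rewrite -ad a1 in TA *.
  have [z ->] := gD b TA; exists false, z; split; first exact: mem_head.
  by rewrite mx2_unipotentX mul1r expr0 scale1r.
have [|z bz] := gD (- b).
  by have := mgN TG TA; rewrite mx2_opp opprK oppr0.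
exists true, z; split; first exact: mem_head.
by rewrite mx2_unipotentX mul1r expr1 scaleN1r -bz mx2_opp opprK oppr0.
Qed.

End Parabolic.

(** The interval from -1 to 1 is cut into cells of length [e]; the index runs up to the truncation
    of [2 / e], inclusive, to cover the right end. *)
Lemma finite_cells (R : realType) (e : R) : 0 < e ->
  exists (K : nat) (f : R -> 'I_K.+1), forall x y,
    `|x| <= 1 -> `|y| <= 1 -> f x = f y -> `|x - y| < e.
Proof.
move=> e0; exists (Num.truncn (2 / e)), (fun x => inord (Num.truncn ((x + 1) / e))).
move=> x y; rewrite !ler_norml => /andP[x1 x2] /andP[y1 y2] /(congr1 val) /=.
have bnd z : -1 <= z -> z <= 1 -> (Num.truncn ((z + 1) / e) < (Num.truncn (2 / e)).+1)%N.
  by move=> z1 z2; rewrite ltnS le_truncn// ler_pM2r ?invr_gt0//; lra.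
rewrite !inordK ?bnd// => E.
have itv z : -1 <= z -> (Num.truncn ((z + 1) / e))%:R * e <= z + 1 <
    (Num.truncn ((z + 1) / e))%:R * e + e.
  move=> z1; have z0 : 0 <= (z + 1) / e by rewrite divr_ge0//; lra.
  have /andP[t1 t2] := truncn_itv z0; rewrite -ler_pdivlMr// t1/=.
  by move: t2; rewrite -natr1 ltr_pdivrMr// mulrDl mul1r.
have := itv _ x1; have := itv _ y1; rewrite E => /andP[? ?] /andP[? ?].
by rewrite ltr_norml; apply/andP; split; lra.
Qed.

(** * Groups with a rotation and without hyperbolic elements *)

Section Elliptic.
Variables (R : realType) (T : set 'M[R]_2).
Hypothesis TG : matrix_group T.

Let T_det a b c d : T (mx2 a b c d) -> a * d - b * c = 1.
Proof. by move=> /(mg_det TG); rewrite mx2_det. Qed.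

(* For b in SL2 and a rotation e = (c, -d; d, c), the trace of [b, e] is
   2 + d^2 ((p - s)^2 + (q + r)^2). *)
Lemma elliptic_rotation (c d p q r s : R) :
  (forall A, T A -> `|\tr A| <= 2) -> d != 0 -> T (mx2 c (- d) d c) ->
  T (mx2 p q r s) -> p = s /\ q = - r.
Proof.
move=> tr2 d0 Te Tb; have := T_det Te; have := T_det Tb => psqr cd.
have := tr2 _ (mgM TG (mgM TG Tb Te) (mgM TG (mgV TG Tb) (mgV TG Te))).
rewrite !mx2_inv// !mx2_mul mx2_tr => /(le_trans (ler_norm _)).
set t := (X in X <= 2 -> _).
have -> : t = 2 + d ^+ 2 * ((p - s) ^+ 2 + (q + r) ^+ 2).
  (* The identity is polynomial once 2 is multiplied by the two determinants, both equal to 1. *)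
  transitivity (2 * (p * s - q * r) * (c * c - - d * d) +
      d ^+ 2 * ((p - s) ^+ 2 + (q + r) ^+ 2)); first by rewrite /t; ring.
  by rewrite psqr cd; ring.
rewrite gerDl pmulr_rle0 ?exprn_even_gt0// => le0.
have := sqr_ge0 (p - s); have := sqr_ge0 (q + r) => h1 h2.
have /eqP : (p - s) ^+ 2 = 0 by lra.
have /eqP : (q + r) ^+ 2 = 0 by lra.
by rewrite !sqrf_eq0 subr_eq0 addr_eq0 => /eqP-> /eqP->.
Qed.

(** All elements are rotations. Two of them in the same cell of a fine grid have a quotient near 1,
    hence are equal by discreteness; so [T] is finite. *)
Lemma elliptic_elementary (c d : R) :
  (forall A, T A -> `|\tr A| <= 2) -> d != 0 -> T (mx2 c (- d) d c) ->
  matrix_elementary T.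
Proof.
move=> tr2 d0 Te0; have [e e0 Te] := mg_discrete TG.
have rot A : T A -> exists a b, A = mx2 a (- b) b a /\ a ^+ 2 + b ^+ 2 = 1.
  rewrite (mx2E A) => TA; have [E1 E2] := elliptic_rotation tr2 d0 Te0 TA.
  rewrite E1 E2 in TA *; exists (A 1 1), (A 1 0); split => //.
  by rewrite -(T_det TA); ring.
have e20 : 0 < e / 2 by lra.
have [K [f fP]] := finite_cells e20.
pose F (A : 'M[R]_2) := (f (A 0 0), f (A 1 0)).
(* One representative for each cell; the default 1 fills the cells that contain no element of
   [T]. *)
exists 1, [seq xget 1 [set B | T B /\ F B = k] | k <- enum {: 'I_K.+1 * 'I_K.+1}].
split; first exact: mg1 TG.
move=> A TA; exists A, false, 0; split; last by rewrite expr0 scale1r expr0z mulr1.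
apply/mapP; exists (F A); first by rewrite mem_enum.
have := xgetPex 1 (ex_intro [set B | T B /\ F B = F A] A (conj TA erefl)).
set B := xget _ _ => -[TB FB].
have [a [b [DA ab]]] := rot _ TA; have [a' [b' [DB ab']]] := rot _ TB.
have [fa fb] : f a' = f a /\ f b' = f b.
  by move: FB; rewrite /F DA DB !mxE /= => -[].
have [a1 b1 a1' b1'] : [/\ `|a| <= 1, `|b| <= 1, `|a'| <= 1 & `|b'| <= 1].
  by split; rewrite ler_norml; apply/andP; split; nra.
have a'a := fP _ _ a1' a1 fa; have b'b := fP _ _ b1' b1 fb.
have ab1 : a * a - - b * b = 1 by rewrite -ab; ring.
have Au : A \is a GRing.unit by rewrite DA mx2_unit ab1 unitr1.
have Au' : A^-1 \is a GRing.unit by rewrite unitrV.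
suff AB1 : A^-1 * B = 1 by apply: (mulrI Au'); rewrite AB1 mulVr.
apply: Te; first by apply: mgM => //; apply: mgV.
have small x y : `|x| <= 1 -> `|y| <= 1 -> `|x * (a' - a) + y * (b' - b)| < e.
  move=> x1 y1; apply: (le_lt_trans (ler_normD _ _)); rewrite !normrM.
  have := ler_pM (normr_ge0 x) (normr_ge0 (a' - a)) x1 (lexx _).
  have := ler_pM (normr_ge0 y) (normr_ge0 (b' - b)) y1 (lexx _).
  by rewrite !mul1r; lra.
rewrite DA DB mx2_inv// mx2_mul; apply: near_id_mx2.
- by rewrite [X in `|X|](_ : _ = a * (a' - a) + b * (b' - b)) ?small//; rewrite -ab; ring.
- by rewrite [X in `|X|](_ : _ = b * (a' - a) + - a * (b' - b)) ?small ?normrN//; ring.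
- by rewrite [X in `|X|](_ : _ = - b * (a' - a) + a * (b' - b)) ?small ?normrN//; ring.
- by rewrite [X in `|X|](_ : _ = a * (a' - a) + b * (b' - b)) ?small//; rewrite -ab; ring.
Qed.

End Elliptic.

Lemma conj_setI (R : realType) (P A B : 'M[R]_2) (T : set 'M[R]_2) :
  P \is a GRing.unit -> T A -> P * A = B * P -> conj_set P T B.
Proof. by move=> Pu TA PA; exists A => //; rewrite PA mulrK. Qed.

Lemma elliptic_normal_form (R : realType) (A : 'M[R]_2) :
  \det A = 1 -> `|\tr A| < 2 -> exists (P : 'M[R]_2) (c d : R),
    [/\ P \is a GRing.unit, d != 0 & P * A = mx2 c (- d) d c * P].
Proof.
rewrite (mx2E A) mx2_det mx2_tr.
move: (A 0 0) (A 0 1) (A 1 0) (A 1 1) => a b c d D.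
rewrite ltr_norml => /andP[t1 t2].
pose x := (a + d) / 2; pose y := Num.sqrt (1 - x ^+ 2).
have tt : 0 < (2 - (a + d)) * (2 + (a + d)) by rewrite mulr_gt0//; lra.
have x2 : 0 < 1 - x ^+ 2.
  by rewrite (_ : 1 - x ^+ 2 = (2 - (a + d)) * (2 + (a + d)) / 4) /x; [lra|field].
have y0 : y != 0 by rewrite gt_eqF// sqrtr_gt0.
have y2 : y ^+ 2 = 1 - x ^+ 2 by rewrite sqr_sqrtr// ltW.
(* If [b] were 0, then [a * d = 1] and [(a - d) ^+ 2] would be the negative number
   [(a + d) ^+ 2 - 4]. *)
have b0 : b != 0 by apply/eqP => b0; rewrite b0 in D; have := sqr_ge0 (a - d); lra.
(* With [(1, 0)] as first row of [P], the first row of the equation determines the second. *)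
exists (mx2 1 0 ((x - a) / y) (- b / y)), x, y; split=> //.
  by rewrite mx2_unit mul1r mul0r subr0 unitfE mulf_neq0 ?oppr_eq0 ?invr_eq0.
have Dd : d = 2 * x - a by rewrite /x; field.
have bc : b * c = a * (2 * x - a) - 1 by rewrite -Dd -D; ring.
rewrite !mx2_mul Dd; congr mx2.
- by field.
- by field.
- apply: (mulIf y0); rewrite [LHS]mulrDl [RHS]mulrDl.
  transitivity ((x - a) * a - b * c); first by field.
  transitivity (y ^+ 2 + x * (x - a)); last by field.
  by rewrite bc y2; ring.
- by field.
Qed.

(** Since [(A - 1) ^+ 2 = 0] by Cayley-Hamilton, the rows [v] and [v (A - 1)] work for any [v] not
    fixed by [A]; one of the two basis vectors is such a [v]. *)
Lemma parabolic_normal_form (R : realType) (A : 'M[R]_2) :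
  \det A = 1 -> \tr A = 2 -> A <> 1 -> exists2 P : 'M[R]_2,
    P \is a GRing.unit & P * A = mx2 1 1 0 1 * P.
Proof.
rewrite (mx2E A) mx2_det mx2_tr.
move: (A 0 0) (A 0 1) (A 1 0) (A 1 1) => a b c d D t A1.
have Dd : d = 2 - a by lra.
rewrite {}Dd in D A1 *; have [b0|b0] := eqVneq b 0.
  have a1 : a = 1.
    by apply/eqP; rewrite -subr_eq0 -sqrf_eq0; apply/eqP; rewrite b0 in D; lra.
  have c0 : c != 0.
    by apply/eqP => c0; apply: A1; rewrite b0 c0 a1 -mx2_1; congr mx2; ring.
  exists (mx2 0 1 c 0); first by rewrite mx2_unit unitfE mul0r mul1r sub0r oppr_eq0.
  by rewrite !mx2_mul a1 b0; congr mx2; ring.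
exists (mx2 1 0 (a - 1) b); first by rewrite mx2_unit unitfE mul1r mul0r subr0.
by rewrite !mx2_mul; congr mx2; lra.
Qed.

(** Either some trace is less than 2 in absolute value and its element is conjugate to a rotation,
    or some element other than 1 and -1 is, up to sign, conjugate to a unipotent, or only 1 and -1
    can occur. *)
Lemma no_hyperbolic_elementary (R : realType) (T : set 'M[R]_2) :
  matrix_group T -> (forall A, T A -> `|\tr A| <= 2) -> matrix_elementary T.
Proof.
move=> TG tr2.
have conj_tr2 P : P \is a GRing.unit -> forall A, conj_set P T A -> `|\tr A| <= 2.
  by move=> Pu _ [A TA <-]; rewrite mxtrace_conj// tr2.
have [[A TA trA]|noell] := pselect (exists2 A, T A & `|\tr A| < 2).
  have [P [c [d [Pu d0 PA]]]] := elliptic_normal_form (mg_det TG TA) trA.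
  apply: (conj_elementary Pu); have TG' := conj_matrix_group Pu TG.
  exact: (elliptic_elementary TG' (conj_tr2 P Pu) d0 (conj_setI Pu TA PA)).
have trE A : T A -> \tr A = 2 \/ \tr A = -2.
  move=> TA; have := tr2 A TA; rewrite le_eqVlt => /orP[/eqP trA|trA]; last first.
    by case: noell; exists A.
  by case: (ger0P (\tr A)) trA => _ => [|<-]; [left|right; rewrite opprK].
have [[A [TA A1 AN1]]|triv] := pselect (exists A, [/\ T A, A <> 1 & A <> -1]); last first.
  exists 1, [:: 1; -1]; split; first exact: mg1 TG.
  move=> A TA; exists A, false, 0; split; last by rewrite expr0 scale1r expr0z mulr1.
  rewrite !inE; apply: contrapT => /negP; rewrite negb_or => /andP[/eqP A1 /eqP A2].
  by apply: triv; exists A.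
wlog trA : A TA A1 AN1 / \tr A = 2.
  move=> wh; have [|trA] := trE A TA; first exact: wh.
  apply: (wh (- A)); first exact: mgN TG _ TA.
  - by move=> E; apply: AN1; rewrite -E opprK.
  - by move=> E; apply: A1; rewrite -[A]opprK E opprK.
  - by rewrite raddfN /= trA opprK.
have [P Pu PA] := parabolic_normal_form (mg_det TG TA) trA A1.
apply: (conj_elementary Pu); have TG' := conj_matrix_group Pu TG.
exact: (parabolic_elementary TG' (conj_tr2 P Pu) (oner_neq0 _) (conj_setI Pu TA PA)).
Qed.

Lemma sum_inverse_root (R : rcfType) (t : R) : 2 < t -> exists2 x : R, 1 < x & t = x + x^-1.
Proof.
move=> t2; have D : 0 < t ^+ 2 - 4 by nra.
have s0 : 0 < Num.sqrt (t ^+ 2 - 4) by rewrite sqrtr_gt0.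
have s2 := sqr_sqrtr (ltW D); move: (Num.sqrt _) s0 s2 => s s0 s2.
exists ((t + s) / 2); first by lra.
have ts : (t + s) / 2 * ((t - s) / 2) = 1.
  by transitivity ((t ^+ 2 - s ^+ 2) / 4); [field|rewrite s2; field].
have -> : ((t + s) / 2)^-1 = (t - s) / 2.
  have x0 : (t + s) / 2 != 0 by rewrite gt_eqF//; lra.
  by apply: (mulfI x0); rewrite divff.
by field.
Qed.

(** * Groups with a diagonal hyperbolic element *)

Section Hyperbolic.
Variables (R : realType) (T : set 'M[R]_2) (l : R).
Hypotheses (TG : matrix_group T) (l1 : 1 < l) (Tl : T (mx2 l 0 0 l^-1)).

Let l_gt0 : 0 < l. Proof. exact: lt_trans l1. Qed.
Let l_neq0 : l != 0. Proof. by rewrite gt_eqF. Qed.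

Let T_det a b c d : T (mx2 a b c d) -> a * d - b * c = 1.
Proof. by move=> /(mg_det TG); rewrite mx2_det. Qed.

Let TlX n : T (mx2 (l ^+ n) 0 0 (l ^- n)).
Proof.
elim: n => [|n IHn]; first by rewrite expr0 invr1 mx2_1; exact: mg1 TG.
have := mgM TG Tl IHn; rewrite mx2_mul !exprS invfM.
by congr (T (mx2 _ _ _ _)); ring.
Qed.

Let T_inv a b c d : T (mx2 a b c d) -> T (mx2 d (- b) (- c) a).
Proof. by move=> TA; rewrite -mx2_inv ?T_det//; exact: mgV TG _ TA. Qed.

Let small_power (e x : R) : 0 < e -> exists n, `|x / l ^+ n| < e.
Proof.
move=> e0; have [n _ xn] := expr_unbounded (`|x| / e) 0 l1; exists n.
have ln0 : 0 < l ^+ n by rewrite exprn_gt0.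
rewrite normrM normfV (gtr0_norm ln0) ltr_pdivrMr//.
by move: xn; rewrite ltr_pdivrMr// mulrC.
Qed.

(** Conjugation by the inverse of [diag(l ^+ n, l ^- n)] divides [x] by [l ^+ n] twice, so a
    nontrivial element would have conjugates accumulating at 1. *)
Lemma no_upper_unipotent x : T (mx2 1 x 0 1) -> x = 0.
Proof.
move=> Tx; have [e e0 Te] := mg_discrete TG; have [n xn] := small_power x e0.
have ln0 : l ^+ n != 0 by rewrite expf_neq0.
have xe : `|x / l ^+ n / l ^+ n| < e.
  apply: le_lt_trans xn; rewrite [leLHS]normrM ler_piMr// normfV invf_le1.
    by rewrite ger0_norm ?exprn_ege1 ?exprn_ge0// ltW.
  by rewrite normr_gt0.
have Tc : T (mx2 1 (x / l ^+ n / l ^+ n) 0 1).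
  have := mgM TG (mgM TG (T_inv (TlX n)) Tx) (TlX n).
  by rewrite !mx2_mul; congr (T (mx2 _ _ _ _)); field.
have : mx2 1 (x / l ^+ n / l ^+ n) 0 1 = 1.
  by apply: Te => //; apply: near_id_mx2; rewrite ?subrr ?normr0.
rewrite -mx2_1 => /mx2_inj[_ /eqP + _ _].
by rewrite !mulf_eq0 !invr_eq0 (negPf ln0) !orbF => /eqP.
Qed.

Lemma no_lower_unipotent x : T (mx2 1 0 x 1) -> x = 0.
Proof.
move=> Tx; have [e e0 Te] := mg_discrete TG; have [n xn] := small_power x e0.
have ln0 : l ^+ n != 0 by rewrite expf_neq0.
have xe : `|x / l ^+ n / l ^+ n| < e.
  apply: le_lt_trans xn; rewrite [leLHS]normrM ler_piMr// normfV invf_le1.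
    by rewrite ger0_norm ?exprn_ege1 ?exprn_ge0// ltW.
  by rewrite normr_gt0.
have Tc : T (mx2 1 0 (x / l ^+ n / l ^+ n) 1).
  have := mgM TG (mgM TG (TlX n) Tx) (T_inv (TlX n)).
  by rewrite !mx2_mul; congr (T (mx2 _ _ _ _)); field.
have : mx2 1 0 (x / l ^+ n / l ^+ n) 1 = 1.
  by apply: Te => //; apply: near_id_mx2; rewrite ?subrr ?normr0.
rewrite -mx2_1 => /mx2_inj[_ _ /eqP + _].
by rewrite !mulf_eq0 !invr_eq0 (negPf ln0) !orbF => /eqP.
Qed.

Lemma commensurable_diagonal p q r s : traces_commensurable T ->
  T (mx2 p q r s) -> p != 0 -> p * s = 1.
Proof.
move=> Tc; wlog p0 : p q r s / 0 < p.
  move=> wh Tb; rewrite neq_lt => /orP[p0|p0]; last by apply: wh (Tb) _; rewrite ?gt_eqF.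
  rewrite -mulrNN; apply: (wh (- p) (- q) (- r) (- s)); rewrite ?oppr_gt0 ?oppr_eq0 ?lt_eqF//.
  by rewrite -mx2_opp; exact: mgN TG _ Tb.
(* From [n0] on, the trace [l ^+ n * p + s / l ^+ n] exceeds 2. Below [n0] the values of [mu] are
   arbitrary. *)
move=> Tb _; have [n0 _ n0P] := expr_unbounded ((2 + `|s|) / p) 0 l1.
have mu_ex n : exists x : R, (n0 <= n)%N ->
    1 < x /\ l ^+ n * p + s / l ^+ n = x + x^-1.
  have [n0n|] := boolP (n0 <= n)%N; last by exists 0.
  have [|x x1 E] := @sum_inverse_root R (l ^+ n * p + s / l ^+ n); last by exists x.
  have ln1 : 1 <= l ^+ n by rewrite exprn_ege1// ltW.
  have lnn : l ^+ n0 <= l ^+ n by rewrite ler_weXn2l// ltW.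
  have sl : `|s / l ^+ n| <= `|s|.
    by rewrite normrM normfV (@ger0_norm _ (l ^+ n)) ?ler_piMr// ?invf_le1; lra.
  have : 2 + `|s| < l ^+ n * p by move: n0P; rewrite ltr_pdivrMr//; nra.
  by move: sl; rewrite ler_norml => /andP[]; lra.
have [mu muP] := choice mu_ex.
apply: (@commensurable_traces R l p s n0 mu l1 p0).
- by move=> n /muP[].
- by move=> n /muP[].
- move=> n n0n; have [mu1 E] := muP n n0n.
  apply: (Tc _ _ l (mu n) Tl (mgM TG (TlX n) Tb) l1 mu1); first by rewrite mx2_tr.
  by rewrite mx2_mul mx2_tr -E; ring.
Qed.

(** If [p] is nonzero, then [p * s = 1] makes [q * r] vanish. The commutator of the resulting
    triangular matrix with the diagonal element or its inverse is unipotent, hence trivial, which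
    kills the other off-diagonal entry. *)
Lemma diagonal_or_antidiagonal p q r s : traces_commensurable T ->
  T (mx2 p q r s) -> (p = 0 /\ s = 0) \/ (q = 0 /\ r = 0).
Proof.
move=> Tc Tb; have D := T_det Tb.
have [p0|p0] := eqVneq p 0.
  (* The inverse has [s] in the upper left corner, so a nonzero [s] would give [s * p = 1]. *)
  left; split => //; apply: contrapT => /eqP s0.
  have := commensurable_diagonal Tc (T_inv Tb) s0; rewrite p0 mulr0 => /esym/eqP.
  by rewrite oner_eq0.
right; have ps := commensurable_diagonal Tc Tb p0.
have s0 : s != 0 by apply: contra_eq_neq ps => ->; rewrite mulr0 eq_sym oner_neq0.
have l2 : l ^- 2 - 1 != 0.
  by rewrite subr_eq0 invr_eq1 gt_eqF// exprn_egt1.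
have : q * r = 0 by lra.
move/eqP; rewrite mulf_eq0 => /orP[]/eqP qr0; split => //; apply/eqP.
- have := mgM TG (mgM TG (mgM TG Tl Tb) (T_inv Tl)) (T_inv Tb).
  have -> : mx2 l 0 0 l^-1 * mx2 p q r s * mx2 l^-1 (- 0) (- 0) l * mx2 s (- q) (- r) p
      = mx2 1 0 (r * s * (l ^- 2 - 1)) 1.
    by rewrite !mx2_mul qr0; congr mx2; by [field|rewrite -ps; field].
  move/no_lower_unipotent => /eqP.
  by rewrite !mulf_eq0 (negPf s0) (negPf l2) !orbF.
- have := mgM TG (mgM TG (mgM TG (T_inv Tl) Tb) Tl) (T_inv Tb).
  have -> : mx2 l^-1 (- 0) (- 0) l * mx2 p q r s * mx2 l 0 0 l^-1 * mx2 s (- q) (- r) p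
      = mx2 1 (p * q * (l ^- 2 - 1)) 0 1.
    by rewrite !mx2_mul qr0; congr mx2; by [field|rewrite -ps; field].
  move/no_upper_unipotent => /eqP.
  by rewrite !mulf_eq0 (negPf p0) (negPf l2) !orbF.
Qed.

(** The logarithm identifies the positive diagonal elements with a discrete subgroup of the reals;
    the negative ones differ from these by the sign. *)
Lemma diagonal_subgroup_cyclic : exists2 g : 'M[R]_2, T g &
  forall p s, T (mx2 p 0 0 s) -> exists (b : bool) (z : int),
    mx2 p 0 0 s = (-1) ^+ b *: g ^ z.
Proof.
have [e e0 Te] := mg_discrete TG.
pose D : set R := [set y | T (mx2 (expR y) 0 0 (expR (- y)))].
have D0 : D 0 by rewrite /D/= oppr0 expR0 mx2_1; exact: mg1 TG.
have DB x y : D x -> D y -> D (x - y).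
  move=> Dx Dy; have := mgM TG Dx (T_inv Dy); rewrite mx2_mul /D/=.
  by rewrite opprB [y - x]addrC !expRD; congr (T (mx2 _ _ _ _)); ring.
(* If [|y| < ln (1 + e)], then [expR y] and its inverse are both below [1 + e], hence both within
   [e] of 1. *)
have le0 : 0 < ln (1 + e) by rewrite ln_gt0//; lra.
have De y : D y -> `|y| < ln (1 + e) -> y = 0.
  rewrite ltr_norml => Dy /andP[y1 y2].
  have u1 : expR y < 1 + e by rewrite -[1 + e]lnK ?ltr_expR// posrE; lra.
  have v1 : expR (- y) < 1 + e.
    by rewrite -[1 + e]lnK ?posrE; [rewrite ltr_expR; lra|lra].
  have uv : expR y * expR (- y) = 1 by rewrite expRN divff// gt_eqF// expR_gt0.
  have u0 := expR_gt0 y; have v0 := expR_gt0 (- y).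
  have : mx2 (expR y) 0 0 (expR (- y)) = 1.
    by apply: Te => //; apply: near_id_mx2; rewrite ?normr0// ltr_norml;
      apply/andP; split; nra.
  by rewrite -mx2_1 => /mx2_inj[+ _ _ _]; rewrite -expR0 => /expR_inj.
have [g Dg gD] := discrete_additive_cyclic le0 D0 DB De.
exists (mx2 (expR g) 0 0 (expR (- g))) => // p s.
have pos p' s' : 0 < p' -> T (mx2 p' 0 0 s') -> exists z : int,
    mx2 p' 0 0 s' = mx2 (expR g) 0 0 (expR (- g)) ^ z.
  move=> p0 Tps; have := T_det Tps; rewrite mulr0 subr0 => ps.
  have s'E : s' = p'^-1 by apply: (mulfI (lt0r_neq0 p0)); rewrite ps divff ?lt0r_neq0.
  have [|z zg] := gD (ln p'); first by rewrite /D/= expRN lnK// -s'E.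
  exists z; rewrite expRN mx2_diagX ?lt0r_neq0 ?expR_gt0// s'E.
  have -> : p' = expR g ^ z; last by [].
  rewrite -[p']lnK// zg; case: z {zg} => n; first by rewrite expRM_natl -exprnP.
  by rewrite NegzE mulrNz mulNr expRN expRM_natl exprnN.
move=> Tps; have := T_det Tps; rewrite mulr0 subr0 => ps.
have p0 : p != 0 by apply: contra_eq_neq ps => ->; rewrite mul0r eq_sym oner_neq0.
move: p0; rewrite neq_lt => /orP[p0|p0]; last first.
  by have [z Ez] := pos _ _ p0 Tps; exists false, z; rewrite expr0 scale1r.
have [|//|z Ez] := pos (- p) (- s); first by rewrite oppr_gt0.
  by have := mgN TG Tps; rewrite mx2_opp oppr0.
by exists true, z; rewrite expr1 scaleN1r -Ez mx2_opp !opprK oppr0.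
Qed.

(** The quotient of two antidiagonal elements is diagonal, so a single antidiagonal [w], if there is
    one, represents them all. *)
Lemma hyperbolic_elementary : traces_commensurable T -> matrix_elementary T.
Proof.
move=> Tc; have [g Tg gP] := diagonal_subgroup_cyclic.
have [[w [Tw [w0 w1]]]|nw] := pselect (exists w, T w /\ (w 0 0 = 0 /\ w 1 1 = 0)); last first.
  exists g, [:: 1]; split => // A TA; exists 1; rewrite (mx2E A) in TA *.
  case: (diagonal_or_antidiagonal Tc TA) => [[a0 d0]|[b0 c0]].
    by case: nw; exists A; split => //; rewrite (mx2E A).
  rewrite b0 c0 in TA *; have [b [z ->]] := gP _ _ TA.
  by exists b, z; rewrite mem_head mul1r.
exists g, [:: 1; w]; split => // A; rewrite (mx2E A) => TA.
case: (diagonal_or_antidiagonal Tc TA) => [[a0 d0]|[b0 c0]]; last first.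
  rewrite b0 c0 in TA *; have [b [z ->]] := gP _ _ TA.
  by exists 1, b, z; rewrite mem_head mul1r.
rewrite a0 d0 in TA *; rewrite (mx2E w) w0 w1 in Tw *.
have := mgM TG (T_inv Tw) TA; rewrite mx2_mul !(mulr0, mul0r, addr0, add0r).
move=> /gP[b [z Ez]]; exists (mx2 0 (w 0 1) (w 1 0) 0), b, z.
rewrite !inE eqxx orbT; split => //; rewrite scalerAr -Ez mx2_mul.
by have := T_det Tw; rewrite mul0r sub0r => D; congr mx2; by [ring|rewrite -[LHS]mul1r -D; ring].
Qed.

End Hyperbolic.

(** The rows of [P] are left eigenvectors of [A] for [x] and [x^-1], with a formula depending on
    which off-diagonal entry is nonzero. A diagonal [A] requires at most a swap. *)
Lemma hyperbolic_normal_form (R : realType) (A : 'M[R]_2) (x : R) :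
  \det A = 1 -> \tr A = x + x^-1 -> 1 < x -> exists2 P : 'M[R]_2,
    P \is a GRing.unit & P * A = mx2 x 0 0 x^-1 * P.
Proof.
rewrite (mx2E A) mx2_det mx2_tr.
move: (A 0 0) (A 0 1) (A 1 0) (A 1 1) => a b c d D t x1.
have x0 : x != 0 by rewrite gt_eqF//; lra.
have x'1 : x^-1 < 1 by rewrite invf_lt1//; lra.
have xx' : x * x^-1 = 1 by rewrite mulfV.
have xx'0 : x - x^-1 != 0 by rewrite gt_eqF//; lra.
move: x^-1 t x'1 xx' xx'0 => x' t x'1 xx' xx'0.
have Dd : d = x + x' - a by lra.
rewrite {}Dd in D *; have [b0|b0] := eqVneq b 0; last first.
  exists (mx2 (x - (x + x' - a)) b (x' - (x + x' - a)) b).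
    by rewrite mx2_unit unitfE (_ : _ - _ = b * (x - x')) ?mulf_neq0//; ring.
  by rewrite !mx2_mul; congr mx2; lra.
have [c0|c0] := eqVneq c 0; last first.
  exists (mx2 c (x - a) c (x' - a)).
    rewrite mx2_unit unitfE (_ : _ - _ = - (c * (x - x'))); last by ring.
    by rewrite oppr_eq0 mulf_neq0.
  by rewrite !mx2_mul b0 in D *; congr mx2; lra.
rewrite b0 c0 in D *; have : (a - x) * (a - x') = 0 by lra.
move/eqP; rewrite mulf_eq0 !subr_eq0 => /orP[]/eqP->.
  by exists 1; [exact: unitr1|rewrite mul1r mulr1; congr mx2; ring].
exists (mx2 0 1 1 0); first by rewrite mx2_unit unitfE mul0r mul1r sub0r oppr_eq0 oner_neq0.
by rewrite !mx2_mul; congr mx2; ring.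
Qed.

Lemma traces_commensurable_elementary (R : realType) (T : set 'M[R]_2) :
  matrix_group T -> traces_commensurable T -> matrix_elementary T.
Proof.
move=> TG Tc.
have [[A TA trA]|nohyp] := pselect (exists2 A, T A & 2 < \tr A).
  have [x x1 Ex] := sum_inverse_root trA.
  have [P Pu PA] := hyperbolic_normal_form (mg_det TG TA) Ex x1.
  apply: (conj_elementary Pu); have TG' := conj_matrix_group Pu TG.
  exact: (hyperbolic_elementary TG' x1 (conj_setI Pu TA PA) (conj_traces Pu Tc)).
apply: no_hyperbolic_elementary => // A TA; rewrite leNgt; apply/negP => trA.
apply: nohyp; case: (ger0P (\tr A)) trA => _ trA; first by exists A.
by exists (- A); [exact: mgN TG _ TA|rewrite raddfN].
Qed.

(** * Fuchsian groups *)

(** Clearing denominators in a rational relation gives integers with [q * ln y = - p * ln x]. Both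
    are nonzero since both logarithms are, and absolute values give the exponents. *)
Lemma Q_dependent_powers (R : realType) (x y : R) : 1 < x -> 1 < y ->
  ~ Q_independent (2 * ln x) (2 * ln y) ->
  exists k m : nat, [/\ (0 < k)%N, (0 < m)%N & y ^+ k = x ^+ m].
Proof.
move=> x1 y1 dep; have lx : 0 < ln x by rewrite ln_gt0.
have ly : 0 < ln y by rewrite ln_gt0.
have [a [b [ab0 E]]] : exists a b : rat,
    ~ (a = 0 /\ b = 0) /\ ratr a * (2 * ln x) + ratr b * (2 * ln y) = 0.
  apply: contrapT => nab; apply: dep => a b E; apply: contrapT => ab0.
  by apply: nab; exists a, b.
have den0 (c : rat) : (denq c)%:~R != 0 :> R by rewrite intr_eq0 denq_neq0.
pose p := numq a * denq b; pose q := numq b * denq a.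
have pq : q%:~R * ln y = - (p%:~R * ln x).
  apply/eqP; rewrite -subr_eq0 opprK; apply/eqP.
  transitivity ((denq a)%:~R * (denq b)%:~R / 2 *
    (ratr a * (2 * ln x) + ratr b * (2 * ln y))); last by rewrite E mulr0.
  by rewrite /p /q !rmorphM /= /ratr; field; rewrite !den0.
have pq_eq0 : (p == 0) = (q == 0).
  apply/eqP/eqP => [p0|q0]; move/eqP: pq.
    by rewrite p0 mul0r oppr0 mulf_eq0 (gt_eqF ly) orbF intr_eq0 => /eqP.
  by rewrite q0 mul0r eq_sym oppr_eq0 mulf_eq0 (gt_eqF lx) orbF intr_eq0 => /eqP.
have p0 : p != 0.
  apply/negP => p0; apply: ab0; have := p0; rewrite pq_eq0.
  move: p0; rewrite /p /q !mulf_eq0 !numq_eq0 !(negPf (denq_neq0 _)) !orbF.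
  by move=> /eqP-> /eqP->.
exists `|q|%N, `|p|%N; rewrite !absz_gt0 p0 -pq_eq0 p0; split => //.
have [x0 y0] : 0 < x /\ 0 < y by lra.
apply: ln_inj; rewrite ?posrE ?exprn_gt0// !lnXn// -[LHS]mulr_natl -[RHS]mulr_natl !natr_absz !intr_norm.
by rewrite -(gtr0_norm lx) -(gtr0_norm ly) -!normrM pq normrN.
Qed.

Lemma sum_inverse_gt2 (R : realFieldType) (x : R) : 1 < x -> 2 < x + x^-1.
Proof.
move=> x1; have x'0 : 0 < x^-1 by rewrite invr_gt0; lra.
have xx' : x * x^-1 = 1 by rewrite mulfV// gt_eqF//; lra.
by nra.
Qed.

Section FuchsianGroup.
Variables (R : realType) (Gamma : set (PSL2 R)).
Hypothesis Fuchsian_Gamma : Fuchsian Gamma.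

Definition SL2_preimage : set 'M[R]_2 :=
  [set A : 'M[R]_2 | exists2 B : SL2 R, Gamma (\pi_(PSL2 R) B) & A = B].

Let Gamma1 : Gamma 1%g.
Proof. by have [[/set_mem]] := Fuchsian_Gamma. Qed.

Let GammaV x : Gamma x -> Gamma x^-1%g.
Proof.
move=> Gx; have [[_ GB] _] := Fuchsian_Gamma.
by have /set_mem := GB _ _ (mem_set Gamma1) (mem_set Gx); rewrite div1g.
Qed.

Let GammaM x y : Gamma x -> Gamma y -> Gamma (x * y)%g.
Proof.
move=> Gx Gy; have [[_ GB] _] := Fuchsian_Gamma.
by have /set_mem := GB _ _ (mem_set Gx) (mem_set (GammaV Gy)); rewrite invgK.
Qed.

(** The projection is continuous and SL2 carries the subspace topology, for which entrywise balls
    are a neighbourhood base. *)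
Lemma PSL2_near_one (V : set (PSL2 R)) : nbhs (1%g : PSL2 R) V ->
  exists2 e : R, 0 < e & forall A : SL2 R, near_id e A -> V (\pi_(PSL2 R) A).
Proof.
move=> nV; have : nbhs (1%g : SL2 R) (\pi_(PSL2 R) @^-1` V).
  exact: pi_continuous nV.
rewrite nbhsE => -[U [[W oW WU] U1] UV].
have : nbhs (1%:M : 'M[R]_2) W by apply: open_nbhs_nbhs; split => //; rewrite -WU in U1.
move=> /nbhs_ballP[e /= e0 eW]; exists e => // A nA.
apply: UV; rewrite -WU /=; apply: eW; split => // i j.
by rewrite /ball /= distrC mxE; exact: nA.
Qed.

Lemma SL2_preimage_group : matrix_group SL2_preimage.
Proof.
split.
- by move=> _ [A _ ->]; exact: detSL2.
- move=> _ _ [A GA ->] [B GB ->]; exists (A * B)%g => //.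
  by have := GammaM GA GB; rewrite [(_ * _)%g]PSL2_mul_pi.
- move=> _ [A GA ->]; exists A^-1%g => //.
  by have := GammaV GA; rewrite [(_^-1)%g]PSL2_inv_pi.
- by exists 1%g.
- move=> _ [A GA ->].
  have dA : \det (- (A : 'M[R]_2)) == 1.
    by rewrite -scaleN1r detZ detSL2 expr2 mulrNN !mulr1.
  exists (MkSL2 dA) => //.
  by have -> : \pi_(PSL2 R) (MkSL2 dA) = \pi_(PSL2 R) A by apply/PSL2_eqP; right.
- have [_ /(_ _ Gamma1)[_ [V nV VG]]] := Fuchsian_Gamma.
  have [e e0 eV] := PSL2_near_one nV.
  (* Discreteness in PSL2 only yields 1 or -1; a radius of at most 1 excludes -1, whose diagonal
     entries are at distance 2 from 1. *)
  exists (Num.min e 1); first by rewrite lt_min e0 ltr01.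
  move=> _ [A GA ->] nA.
  have : (V `&` Gamma) (\pi_(PSL2 R) A).
    split=> //; apply: eV => i j; apply: lt_le_trans (nA i j) _.
    by rewrite ge_min lexx.
  rewrite VG /= => /PSL2_eqP[//|AE].
  have A00 : (A : 'M[R]_2) 0 0 = -1 by rewrite AE !mxE.
  have : `|(A : 'M[R]_2) 0 0 - 1| < Num.min e 1 := nA 0 0.
  rewrite A00 lt_min => /andP[_].
  by rewrite -opprD normrN ger0_norm ?addr_ge0// gtrDl ltr10.
Qed.

Lemma preimage_elementary : matrix_elementary SL2_preimage -> elementary Gamma.
Proof.
move=> [_ [cs [[g Gg ->] gP]]].
pose H := cyclic_subgroup (\pi_(PSL2 R) g).
have gX (n : nat) : exists2 B : SL2 R, (B : 'M[R]_2) = (g : 'M[R]_2) ^+ n &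
    \pi_(PSL2 R) B = (\pi_(PSL2 R) g ^+ n)%g.
  elim: n => [|n [B BE Bpi]]; first by exists 1%g.
  exists (g * B)%g; first by rewrite exprS -BE.
  by rewrite expgS -Bpi [RHS]PSL2_mul_pi.
have zH (z : int) : exists2 B : SL2 R, (B : 'M[R]_2) = (g : 'M[R]_2) ^ z &
    H (\pi_(PSL2 R) B).
  case: z => n; first by have [B BE Bpi] := gX n; exists B => //; exists n; left.
  have [B BE Bpi] := gX n.+1; exists B^-1%g; first by rewrite NegzE -exprnN -BE.
  by exists n.+1; right; rewrite -Bpi [RHS]PSL2_inv_pi.
have Hz h : H h -> exists (z : int) (B : SL2 R),
    (B : 'M[R]_2) = (g : 'M[R]_2) ^ z /\ h = \pi_(PSL2 R) B.
  move=> [n hn]; have [B BE Bpi] := gX n.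
  case: hn => ->; first by exists n, B.
  exists (- n%:Z), B^-1%g; rewrite -exprnN -BE; split => //.
  by rewrite -Bpi [LHS]PSL2_inv_pi.
have gu : (g : 'M[R]_2) \is a GRing.unit by exact: SL2_unit.
(* The image in PSL2 of the translate of the powers of [g] by [c], meaningful also for [c] of
   determinant other than 1. A coset of [H] turns out to be [F c] for some [c] in [cs]. *)
pose F (c : 'M[R]_2) : set (PSL2 R) := [set x | exists (B : SL2 R) (b : bool) (z : int),
  x = \pi_(PSL2 R) B /\ (B : 'M[R]_2) = (-1) ^+ b *: (c * (g : 'M[R]_2) ^ z)].
exists (\pi_(PSL2 R) g); split.
  move=> x [n xn]; have GX m : Gamma (\pi_(PSL2 R) g ^+ m)%g.
    by elim: m => [|m IHm]; [rewrite expg0|rewrite expgS; exact: GammaM].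
  by case: xn => ->; [exact: GX|exact/GammaV/GX].
have fin : finite_set [set F c | c in [set` cs]] by exact/finite_image/finite_seq.
apply: sub_finite_set fin => _ [x Gx <-].
set A : SL2 R := repr x; have xA : x = \pi_(PSL2 R) A by rewrite reprK.
have [|c [b [z [ccs AE]]]] := gP A; first by exists A; rewrite // -xA.
exists c => //; apply/seteqP; split => [_ [B [b' [z' [-> BE]]]]|_ [h /Hz[z' [B [BE ->]]] <-]].
  have [B0 B0E HB0] := zH (z' - z); exists (\pi_(PSL2 R) B0) => //.
  rewrite xA [LHS]PSL2_mul_pi; apply/PSL2_eqP.
  have -> : (A * B0)%g = (-1) ^+ b *: (c * (g : 'M[R]_2) ^ z') :> 'M[R]_2.
    transitivity ((A : 'M[R]_2) * (B0 : 'M[R]_2)) => //.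
    by rewrite AE B0E -scalerAl -mulrA -exprzDr// addrC subrK.
  rewrite BE; case: b {AE}; case: b' {BE}; rewrite ?expr0 ?expr1 ?scale1r ?scaleN1r ?opprK;
    by [left|right].
exists (A * B)%g, b, (z + z'); split; first by rewrite xA [LHS]PSL2_mul_pi.
transitivity ((A : 'M[R]_2) * (B : 'M[R]_2)) => //.
by rewrite AE BE -scalerAl -mulrA -exprzDr.
Qed.

Lemma length_set_trace (A : SL2 R) (x : R) : Gamma (\pi_(PSL2 R) A) ->
  1 < x -> \tr (A : 'M[R]_2) = x + x^-1 -> length_set Gamma (2 * ln x).
Proof.
move=> GA x1 Ax; have x0 : x != 0 by rewrite gt_eqF// (lt_trans _ x1).
have [P Pu PA] := hyperbolic_normal_form (detSL2 A) Ax x1.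
have Pu' : P \in unitmx by [].
exists (\pi_(PSL2 R) A); first split => //.
  apply/hyperbolic_pi; split; last first.
    exists P => //; apply/diagonalizable_forPex.
    exists (\row_j (if j == 0 then x else x^-1)); apply/(simmxP Pu').
    rewrite [LHS]PA; congr (_ *m _); apply: mx2_ext; rewrite !mxE //=.
  (* The trace of [A] exceeds 2, while 1 and -1 have traces 2 and -2. *)
  move=> /PSL2_eqP A1; have : \tr (A : 'M[R]_2) = 2 \/ \tr (A : 'M[R]_2) = - 2.
    by case: A1 => ->; [left|right]; rewrite ?raddfN /= mxtrace1.
  have := sum_inverse_gt2 x1; rewrite -Ax => t2 [] tE; move: t2; rewrite tE ?ltxx//.
  by apply/negP; rewrite -leNgt -subr_ge0 opprK addr_ge0.
have eA : eigenvalue (A : 'M[R]_2) x.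
  apply/eigenvalueP; exists (row 0 P).
    rewrite -row_mul [_ *m _]PA; apply/rowP => j.
    by rewrite mxE -mulmxE !mxE !big_ord_recl big_ord0 !mxE /=; ring.
  apply/eqP => /(congr1 (mulmx^~ (invmx P))); rewrite rowE mulmxK// mul0mx.
  by move/matrixP/(_ 0 0); rewrite !mxE => /eqP; rewrite oner_eq0.
by rewrite (translation_length_pi eA) ger0_norm//; lra.
Qed.

End FuchsianGroup.

Theorem theorem1p3 (R : realType) (Gamma : set (PSL2 R))
    (Fuchsian_Gamma : Fuchsian Gamma)
    (nonelementary_Gamma : ~ elementary Gamma) :
  exists x y : R,
    [/\ length_set Gamma x, length_set Gamma y & Q_independent x y].
Proof.
apply: contrapT => dep; apply: nonelementary_Gamma.
apply: (preimage_elementary Fuchsian_Gamma).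
apply: traces_commensurable_elementary; first exact: SL2_preimage_group.
move=> _ _ x y [A GA ->] [B GB ->] x1 y1 trA trB.
apply: Q_dependent_powers => // indep; apply: dep; exists (2 * ln x), (2 * ln y).
split => //; [exact: length_set_trace trA|exact: length_set_trace trB].
Qed.
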